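(* Let $L$ be a countable, locally finite CW complex and let $\mathcal C_L$ be the class of all metrizable compacta $K$ with $\text{e-}\dim K\le [L]$. If $\mathcal C_L$ contains a universal element $X_L$ (a metrizable compactum with $\text{e-}\dim X_L\le [L]$ containing a topological copy of every metrizable compactum of extension dimension $\le [L]$) such that $X_L\in AE([L],\mathcal P)$, then $L$ is quasi-finite.
   Context: All spaces are Tychonoff and all maps continuous. For spaces $X,Y$, $Y\in AE(X)$ means every map defined on a closed subspace of $X$ into $Y$ extends over $X$. For a normal space $X$, $\text{e-}\dim X\le [L]$ means $L\in AE(X)$. $\mathcal P$ is the class of Polish spaces, and $Y\in AE([L],\mathcal P)$ means $Y\in AE(Z)$ for every Polish space $Z$ with $\text{e-}\dim Z\le [L]$. A pair of spaces $V\subset U$ is $[L]$-connected with respect to Polish spaces if for every Polish space $Z$ with $\text{e-}\dim Z\le [L]$ and every closed $A\subset Z$, every map $A\to V$ extends to a map $Z\to U$. $L$ is quasi-finite if for every finite subcomplex $P$ of $L$ there is a finite subcomplex $P'\supset P$ of $L$ such that the pair $P\subset P'$ is $[L]$-connected with respect to Polish spaces. *)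

(* Defs.v *)
From HB Require Import structures.
From mathcomp Require Import all_boot all_order all_algebra.
From mathcomp Require Import all_classical all_reals all_analysis.
Set Implicit Arguments. Unset Strict Implicit. Unset Printing Implicit Defensive.
Import Order.TTheory GRing.Theory Num.Theory.
Import numFieldNormedType.Exports.
Local Open Scope classical_set_scope.
Local Open Scope ring_scope.

Section Defs.
Variable R : realType.

Definition closedDisk (n : nat) : set 'rV[R]_n :=
  [set v | \sum_(i < n) (v ord0 i) ^+ 2 <= 1].
Definition openDisk (n : nat) : set 'rV[R]_n :=
  [set v | \sum_(i < n) (v ord0 i) ^+ 2 < 1].
Arguments closedDisk n : clear implicits.
Arguments openDisk n : clear implicits.

Definition cont_on (X Y : topologicalType) (A : set X) (f : {x | A x} -> Y) :=
  forall (a : {x | A x}) (V : set Y), open V -> V (f a) ->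
    exists U : set X, [/\ open U, U (sval a) &
      forall b : {x | A x}, U (sval b) -> V (f b)].

Definition AE (Y X : topologicalType) : Prop :=
  forall (A : set X) (f : {x | A x} -> Y), closed A -> cont_on f ->
    exists g : X -> Y, continuous g /\ forall a : {x | A x}, g (sval a) = f a.

Definition edim_le (X L : topologicalType) : Prop := AE L X.

Definition is_metric (T : Type) (d : T -> T -> R) : Prop :=
  [/\ forall x y, 0 <= d x y, forall x y, d x y = 0 <-> x = y,
      forall x y, d x y = d y x & forall x y z, d x z <= d x y + d y z].
Definition induces_topology (T : topologicalType) (d : T -> T -> R) : Prop :=
  forall A : set T, open A <->
    (forall x, A x -> exists e : R, 0 < e /\ [set y | d x y < e] `<=` A).
Definition complete_metric (T : Type) (d : T -> T -> R) : Prop :=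
  forall u : nat -> T,
    (forall e : R, 0 < e -> exists N : nat, forall m n : nat,
        (N <= m)%N -> (N <= n)%N -> d (u m) (u n) < e) ->
    exists x : T, forall e : R, 0 < e -> exists N : nat, forall n : nat,
        (N <= n)%N -> d (u n) x < e.
Definition metrizable (T : topologicalType) : Prop :=
  exists d : T -> T -> R, is_metric d /\ induces_topology d.
Definition separable (T : topologicalType) : Prop :=
  exists D : set T, countable D /\ closure D = setT.
Definition polish (T : topologicalType) : Prop :=
  separable T /\
  exists d : T -> T -> R, [/\ is_metric d, induces_topology d & complete_metric d].

Definition metrizable_compactum (T : topologicalType) : Prop :=
  compact [set: T] /\ metrizable T.

Definition AE_polish (L Y : topologicalType) : Prop :=
  forall Z : topologicalType, polish Z -> edim_le Z L -> AE Y Z.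

Definition embeds (K X : topologicalType) : Prop :=
  exists e : K -> X, [/\ continuous e, injective e &
    forall U : set K, open U -> exists V : set X, open V /\ e @` U = V `&` range e].

(** CW complexes (Hatcher's characterization): a Hausdorff space L with
    characteristic maps Phi_i : D^{n_i} -> L such that
    (1) Phi_i is continuous on D^{n_i};
    (2) Phi_i restricts to a homeomorphism of int D^{n_i} onto the cell e_i;
    (3) the cells e_i partition L;
    (4) Phi_i (boundary D^{n_i}) lies in finitely many cells of lower dimension;
    (5) A is closed iff Phi_i^{-1}(A) is closed in D^{n_i} for every i. *)
Definition cell (L : topologicalType) (I : Type) (dim : I -> nat)
  (Phi : forall i, 'rV[R]_(dim i) -> L) (i : I) : set L :=
  Phi i @` openDisk (dim i).

Definition is_CW (L : topologicalType) (I : Type) (dim : I -> nat)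
  (Phi : forall i, 'rV[R]_(dim i) -> L) : Prop :=
  hausdorff_space L /\
  [/\ forall i, {within closedDisk (dim i), continuous Phi i},
      forall i, {in openDisk (dim i) &, injective (Phi i)} /\
        (forall U : set 'rV[R]_(dim i), open U ->
           exists V : set L, open V /\
             Phi i @` (U `&` openDisk (dim i)) = V `&` cell Phi i),
      (forall x : L, exists i, cell Phi i x) /\
        (forall i j x, cell Phi i x -> cell Phi j x -> i = j),
      forall i, exists S : set I, [/\ finite_set S,
        forall j, S j -> (dim j < dim i)%N &
        Phi i @` (closedDisk (dim i) `\` openDisk (dim i))
          `<=` \bigcup_(j in S) cell Phi j] &
      forall A : set L, closed A <->
        (forall i, closed (closedDisk (dim i) `&` Phi i @^-1` A))].

Record CWcomplex (L : topologicalType) := CWComplex {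
  cw_idx : Type;
  cw_dim : cw_idx -> nat;
  cw_map : forall i, 'rV[R]_(cw_dim i) -> L;
  cw_ax : is_CW cw_map }.

Section CW.
Variables (L : topologicalType) (C : CWcomplex L).

Definition cw_cell (i : cw_idx C) : set L := cell (@cw_map L C) i.
Definition cw_closed_cell (i : cw_idx C) : set L :=
  @cw_map L C i @` closedDisk (cw_dim i).

Definition cw_countable : Prop := countable [set: cw_idx C].

Definition cw_locally_finite : Prop :=
  forall x : L, exists U : set L, [/\ open U, U x &
    finite_set [set i | cw_closed_cell i `&` U !=set0]].

Definition subcomplex (S : set (cw_idx C)) : Prop :=
  forall i, S i -> cw_closed_cell i `<=` \bigcup_(j in S) cw_cell j.
Definition finite_subcomplex (S : set (cw_idx C)) : Prop :=
  subcomplex S /\ finite_set S.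
Definition support (S : set (cw_idx C)) : set L := \bigcup_(j in S) cw_cell j.

Definition L_connected_pair (V U : set L) : Prop :=
  forall Z : topologicalType, polish Z -> edim_le Z L ->
  forall (A : set Z) (f : {x | A x} -> L), closed A -> cont_on f ->
    (forall a, V (f a)) ->
    exists g : Z -> L, [/\ continuous g, forall z, U (g z) &
      forall a : {x | A x}, g (sval a) = f a].

Definition quasi_finite : Prop :=
  forall P, finite_subcomplex P ->
    exists P', [/\ finite_subcomplex P', P `<=` P' &
      L_connected_pair (support P) (support P')].
End CW.
End Defs.

(* Main.v *)
Require Import Defs.
From HB Require Import structures.
From mathcomp Require Import all_boot all_order all_algebra.
From mathcomp Require Import all_classical all_reals all_analysis.
From mathcomp Require Import ring lra zify.
Local Open Scope classical_set_scope.
Set Implicit Arguments. Unset Strict Implicit. Unset Printing Implicit Defensive.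
Import Order.TTheory GRing.Theory Num.Theory.
Import numFieldNormedType.Exports.
Local Open Scope ring_scope.

(** Cover the finite subcomplex [P] by the cells of a fine cubical grid (after
    embedding a neighbourhood of [P] in some R^J).  Since [X] is universal and
    an absolute extensor for Polish spaces of extension dimension at most [L],
    copies of [X] can be attached to each other along the face relation of the
    grid, and the resulting compactum embeds in [X] again: this gives closed
    copies [X_i] of [X] inside [X], one for each grid cell [D_i], meeting only
    along copies of common faces.

    As [L] is locally contractible and [X] has extension dimension at most [L],
    there is a map [h] from [X] to [L] with [h X_i] close to [D_i].  Now let
    [f] map a closed subset [A] of [Z] to [P], and extend [f] to [f'] from [Z]
    to [L].  Extending cell by cell gives [p] from [Z] to [X] sending the
    preimage of [D_i] under [f'] into [X_i], so [h \o p] is close to [f'] near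
    [A]; and [f'] on [A] is connected to [h \o p] away from [A], again cell by
    cell, inside a fixed neighbourhood of [P].  The values of the resulting
    extension of [f] lie in the union of this neighbourhood and the compact set
    [h X], neither of which depends on [Z], [A] or [f]. *)

(** * Continuity on subsets, absolute extensors, metrizable spaces *)

Section Within.
Context {T S : topologicalType}.
Implicit Types (A B : set T) (f g : T -> S).

Lemma within_openP A f : {within A, continuous f} <->
  forall a (V : set S), A a -> open V -> V (f a) ->
    exists U : set T, [/\ open U, U a & forall b, A b -> U b -> V (f b)].
Proof.
rewrite subspace_continuousP; split=> [cf a V Aa oV Va|cf a Aa V].
  have := cf a Aa V (open_nbhs_nbhs (conj oV Va)).
  rewrite nbhs_simpl /= nbhsE => -[U [oU Ua] UV].
  by exists U; split=> // b Ab Ub; exact: (UV b Ub Ab).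
rewrite nbhsE => -[W [oW Wa] WV].
have [U [oU Ua UW]] := cf a W Aa oW Wa.
rewrite nbhs_simpl /=; apply: filterS (open_nbhs_nbhs (conj oU Ua)) => b Ub Ab.
exact/WV/UW.
Qed.

Lemma within_closedP A f : closed A -> {within A, continuous f} <->
  forall C : set S, closed C -> closed (A `&` f @^-1` C).
Proof.
move=> cA; rewrite continuous_closedP.
by split=> cf C cC; have := cf C cC; rewrite closed_setSI.
Qed.

Lemma eq_within A f g : (forall x, A x -> f x = g x) ->
  {within A, continuous f} -> {within A, continuous g}.
Proof. by move=> fg; apply: subspace_eq_continuous => x /set_mem/fg. Qed.

Lemma withinT f : {within setT, continuous f} <-> continuous f.
Proof. by rewrite continuous_subspace_setT. Qed.

End Within.

Lemma within_comp (T S W : topologicalType) (A : set T) (B : set S)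
    (f : T -> S) (g : S -> W) :
  (forall x, A x -> B (f x)) -> {within A, continuous f} ->
  {within B, continuous g} -> {within A, continuous (g \o f)}.
Proof.
move=> AB /within_openP cf /within_openP cg; apply/within_openP => a V Aa oV Va.
have [U [oU Ua UV]] := cg _ V (AB _ Aa) oV Va.
have [U' [oU' U'a U'U]] := cf _ U Aa oU Ua.
by exists U'; split=> // b Ab U'b; exact: UV (AB _ Ab) (U'U _ Ab U'b).
Qed.

Lemma within_glue_image (N M S : topologicalType) (D : set N) (p : N -> M)
    (Y : set M) (q : M -> S) :
  hausdorff_space M -> compact D -> {within D, continuous p} ->
  closed Y -> {within Y, continuous q} -> {within D, continuous (q \o p)} ->
  {within Y `|` p @` D, continuous q}.
Proof.
move=> hM cD cp cY cq cqp.
have ci E : compact E -> E `<=` D -> closed (p @` E).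
  move=> cE ED; apply: compact_closed => //.
  by apply: continuous_compact => //; exact: continuous_subspaceW cp.
apply: withinU_continuous => //; first exact: ci.
apply/within_closedP; first exact: ci.
move=> C cC; rewrite [X in closed X](_ : _ = p @` (D `&` (q \o p) @^-1` C)).
  apply: ci => //.
  have /continuous_closedP/(_ _ cC)/closed_subspaceP [V cV VD] := cqp.
  by rewrite setIC -VD setIC; exact: compact_closedI.
rewrite eqEsubset; split=> [_ [[x Dx <-] Cx]|_ [x [Dx Cx] <-]].
  by exists x.
by split=> //; exists x.
Qed.

Section AbsoluteExtensors.
Context {Y X : topologicalType}.

Lemma AE_within (f : X -> Y) (A : set X) : AE Y X -> closed A ->
  {within A, continuous f} ->
  exists g : X -> Y, continuous g /\ forall x, A x -> g x = f x.
Proof.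
move=> YX cA /within_openP cf.
have [||g [cg gf]] := YX A (fun a => f (sval a)) => //.
  move=> [a Aa] V oV Va; have [U [oU Ua UV]] := cf a V Aa oV Va.
  by exists U; split=> // -[b Ab] Ub; exact: UV.
by exists g; split=> // x Ax; rewrite (gf (exist _ x Ax)).
Qed.

(** Passes from maps on the subtype of [A] to total functions continuous within [A]; [y0] is the
    value given off [A]. *)
Lemma within_AE (y0 : Y) :
  (forall A (f : X -> Y), closed A -> {within A, continuous f} ->
     exists g : X -> Y, continuous g /\ forall x, A x -> g x = f x) ->
  AE Y X.
Proof.
move=> H A f cA cf.
pose f' x := if pselect (A x) is left a then f (exist _ x a) else y0.
have f'E (a : {x | A x}) : f' (sval a) = f a.
  case: a => x p; rewrite /f' /=; case: pselect => // q.
  by rewrite (Prop_irrelevance q p).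
have [|g [cg gf]] := H A f' cA.
  apply/within_openP => a V Aa oV; rewrite (f'E (exist _ a Aa)) => Va.
  have [U [oU Ua UV]] := cf _ V oV Va; exists U; split=> // b Ab Ub.
  by rewrite (f'E (exist _ b Ab)); exact: UV.
by exists g; split=> // a; rewrite gf ?f'E//; exact: svalP.
Qed.

Lemma AE_exists : AE Y X -> exists f : X -> Y, continuous f.
Proof.
move=> YX.
have [] := YX set0 (fun a : {x | set0 x} => match svalP a with end) closed0.
  by case.
by move=> g [cg _]; exists g.
Qed.

End AbsoluteExtensors.

(** * Metrics and distance functions *)

Section Metric.
Context {R : realType} {T : topologicalType} (d : T -> T -> R).
Hypotheses (dm : is_metric d) (dT : induces_topology d).

Let d0 x y : 0 <= d x y. Proof. by case: dm. Qed.
Let dE x y : d x y = 0 <-> x = y. Proof. by case: dm. Qed.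
Let dC x y : d x y = d y x. Proof. by case: dm. Qed.
Let dD x y z : d x z <= d x y + d y z. Proof. by case: dm. Qed.

Lemma open_metric_ball x e : open [set y | d x y < e].
Proof.
apply/dT => y /= xy; exists (e - d x y); split; first by rewrite subr_gt0.
by move=> z /=; have := dD x y z; lra.
Qed.

Lemma nbhs_metric_ball x e : 0 < e -> nbhs x [set y | d x y < e].
Proof.
move=> e0; apply: open_nbhs_nbhs; split; first exact: open_metric_ball.
by rewrite /= (dE x x).2.
Qed.

Lemma nbhs_metricP x (A : set T) : nbhs x A ->
  exists e : R, 0 < e /\ [set y | d x y < e] `<=` A.
Proof.
rewrite nbhsE => -[U [oU Ux] UA]; have [e [e0 eU]] := (dT U).1 oU x Ux.
by exists e; split=> //; exact: subset_trans UA.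
Qed.

Lemma is_metric_hausdorff : hausdorff_space T.
Proof.
move=> x y xy; apply/dE/eqP/negPn/negP => dxy.
have dxy0 : 0 < d x y / 2 by rewrite divr_gt0// lt_neqAle eq_sym dxy d0.
have [z []] := xy _ _ (nbhs_metric_ball x dxy0) (nbhs_metric_ball y dxy0).
by move=> /= xz; rewrite dC => zy; have := dD x z y; lra.
Qed.

Lemma lipschitz_continuous (f : T -> R) :
  (forall x y, f y - f x <= d x y) -> continuous f.
Proof.
move=> fd x; apply/cvgrPdist_lt => e e0.
apply: filterS (nbhs_metric_ball x e0) => y /= xy.
have := fd x y; have := fd y x; rewrite dC ltr_norml; lra.
Qed.

Lemma metric_continuous x : continuous (d x).
Proof. by apply: lipschitz_continuous => y z; have := dD x y z; lra. Qed.

Lemma metric_distance (S : set T) : closed S -> exists f : T -> R,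
  [/\ continuous f, forall x, 0 <= f x & forall x, f x = 0 <-> S x].
Proof.
(* The distance to [S] is an infimum, which would be meaningless for empty [S]; there the constant 1
   serves. *)
move=> cS; have [->|/set0P [s Ss]] := eqVneq S set0.
  exists (fun=> 1); split=> [|//|x]; first exact: cst_continuous.
  by split=> // /eqP; rewrite oner_eq0.
pose D x := [set d x y | y in S].
have Dinf x : has_inf (D x).
  by split; [exists (d x s), s | exists 0 => _ [y _ <-]].
have infD x y : S y -> inf (D x) <= d x y.
  by move=> Sy; apply: ge_inf; [case: (Dinf x) | exists y].
exists (fun x => inf (D x)); split.
- apply: lipschitz_continuous => x y; rewrite lerBlDl -lerBlDr.
  apply: lb_le_inf; first by case: (Dinf x).
  move=> _ [z Sz <-]; have := infD y z Sz; have := dD y x z.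
  by rewrite (dC y x); lra.
- by move=> x; apply: lb_le_inf => [|_ [y _ <-]//]; case: (Dinf x).
- move=> x; split=> [i0|Sx]; last first.
    apply/eqP; rewrite eq_le; apply/andP; split.
      by have := infD x x Sx; rewrite (dE x x).2.
    by apply: lb_le_inf => [|_ [y _ <-]//]; case: (Dinf x).
  apply: contrapT => nSx.
  have /nbhs_metricP [e [e0 eS]] : nbhs x (~` S).
    by apply: open_nbhs_nbhs; split=> //; exact: closed_openC.
  have [_ [y Sy <-]] := inf_adherent e0 (Dinf x).
  by rewrite i0 add0r => /eS.
Qed.

End Metric.

Section Metrizable.
Context {R : realType} {T : topologicalType}.
Hypothesis mT : metrizable R T.

Lemma metrizable_hausdorff : hausdorff_space T.
Proof. by case: mT => d [dm dT]; exact: is_metric_hausdorff dm dT. Qed.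

Lemma metrizable_distance (S : set T) : closed S -> exists f : T -> R,
  [/\ continuous f, forall x, 0 <= f x & forall x, f x = 0 <-> S x].
Proof. by case: mT => d [dm dT]; exact: metric_distance dm dT S. Qed.

Lemma metrizable_urysohn (A B : set T) : closed A -> closed B ->
  A `&` B = set0 -> exists u : T -> R, [/\ continuous u,
    forall x, A x -> u x = 0 & forall x, B x -> u x = 1].
Proof.
move=> /metrizable_distance [f [cf f0 fE]] /metrizable_distance [g [cg g0 gE]].
move=> AB0.
have fg0 x : f x + g x != 0.
  apply/eqP => fg; have := f0 x; have := g0 x => gx fx.
  have Ax : A x by apply/fE; lra.
  have Bx : B x by apply/gE; lra.
  by have : (A `&` B) x by []; rewrite AB0.
exists (fun x => f x / (f x + g x)); split=> [x|x /fE ->|x /gE gx].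
- apply: cvgM; first exact: cf.
  by apply: cvgV => //; apply: cvgD; [exact: cf | exact: cg].
- by rewrite mul0r.
- by have := fg0 x; rewrite gx addr0 => ?; rewrite divff.
Qed.

End Metrizable.

(** * Polish spaces and metric compacta *)

Lemma polish_metrizable (R : realType) (T : topologicalType) :
  polish R T -> metrizable R T.
Proof. by case=> _ [d [dm dT _]]; exists d. Qed.

(** The distances from [x] to the complement of an open neighbourhood form a compact set of reals
    that misses 0, so some ball about [x] misses the complement. *)
Lemma compact_metric_topology (R : realType) (T : topologicalType)
    (d : T -> T -> R) : compact [set: T] -> is_metric d ->
  (forall x, continuous (d x)) -> induces_topology d.
Proof.
move=> cT dm cd A; have [d0 dE dC dD] := dm; split=> [oA x Ax|H].
  have cA : compact (~` A).
    apply: subclosed_compact (cT) _ => //; exact: open_closedC.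
  have cI : compact (d x @` (~` A)).
    apply: continuous_compact cA; exact: continuous_subspaceT.
  have : nbhs (0 : R) (~` (d x @` (~` A))).
    apply: open_nbhs_nbhs; split.
      by apply: closed_openC; apply: compact_closed cI; exact: Rhausdorff.
    by move=> [y nAy] /dE xy; apply: nAy; rewrite -xy.
  move=> /nbhs_ballP [e /= e0 eB]; exists e; split=> // y /= xye.
  apply: contrapT => nAy; apply: (eB (d x y)); last by exists y.
  by rewrite /ball /= sub0r normrN ger0_norm.
rewrite openE => x Ax; have [e [e0 eA]] := H x Ax.
apply: filterS eA _; apply: (cd x x [set r | r < e]).
apply: open_nbhs_nbhs; split; first exact: open_lt.
by rewrite /= (dE x x).2.
Qed.

Lemma compact_finite_subcover (T : topologicalType) (A : set T)
    (U : T -> set T) : compact A -> (forall x, A x -> nbhs x (U x)) ->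
  exists F : seq T, [/\ forall x, x \in F -> A x &
    forall x, A x -> exists2 y, y \in F & U y x].
Proof.
move=> cA AU; have [->|/set0P [x0 _]] := eqVneq A set0.
  by exists [::]; split.
pose Tp : ptopologicalType := HB.pack T (isPointed.Build T x0).
have : compact (A : set Tp) by [].
rewrite compact_cover => /(_ T A (fun x => (U x)°)) [|x Ax|F FA AF].
- by move=> x _; exact: open_interior.
- by exists x => //; exact: AU.
exists (finmap.enum_fset F); split=> [x /FA/set_mem//|x /AF [y Fy Uy]].
by exists y => //; exact: interior_subset.
Qed.

(** A Cauchy sequence converges to any of its cluster points, and finite nets of mesh [1/(n+1)]
    together form a countable dense set. *)
Lemma compactum_polish (R : realType) (T : topologicalType) :
  metrizable_compactum R T -> polish R T.
Proof.
case=> cT [d [dm dT]]; have [d0 dE dC dD] := dm.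
split; last first.
  exists d; split=> // u uC.
  have [x [_ xu]] := cT (u @ \oo) _ filterT.
  exists x => e e0; have e2 : 0 < e / 2 by rewrite divr_gt0.
  have [N uN] := uC _ e2; exists N => n Nn.
  have un : (u @ \oo) [set y | exists2 m, (N <= m)%N & y = u m].
    by exists N => // m /= Nm; exists m.
  have [_ [[m Nm ->] /= xm]] := xu _ _ un (nbhs_metric_ball dm dT x e2).
  by have := dD (u n) (u m) x; have := uN n m Nn Nm; rewrite (dC (u m) x); lra.
have net (n : nat) : exists F : set T, finite_set F /\
    forall x, exists2 y, F y & d y x < n.+1%:R^-1.
  have [x _|F [_ FT]] := compact_finite_subcover
      (U := fun y => [set x | d y x < n.+1%:R^-1]) cT.
    exact: nbhs_metric_ball.
  exists [set` F]; split=> // x; have [y Fy xy] := FT x Logic.I.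
  by exists y.
have [F FP] := choice net; exists (\bigcup_n F n); split.
  by apply: bigcup_countable => // n _; apply: finite_set_countable; case: (FP n).
rewrite eqEsubset; split=> // x _ U /(nbhs_metricP dT) [e [e0 eU]].
have [n nE] : exists n : nat, n.+1%:R^-1 < e.
  exists (Num.truncn e^-1); rewrite invf_plt ?posrE//.
  by rewrite -truncn_le_nat ?truncnS_gt // ltnW.
have [y Fy yx] := (FP n).2 x; exists y; split; first by exists n.
by apply: eU; rewrite /= dC; exact: lt_trans nE.
Qed.

Lemma continuous_pair (T U V : topologicalType) (f : T -> U) (g : T -> V) :
  continuous f -> continuous g -> continuous (fun x => (f x, g x)).
Proof. by move=> cf cg x; apply: cvg_pair; [exact: cf | exact: cg]. Qed.

Lemma hausdorff_pair (T U : topologicalType) :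
  hausdorff_space T -> hausdorff_space U -> hausdorff_space (T * U)%type.
Proof.
move=> hT hU [x y] [x' y'] H.
have -> : x = x'.
  apply: hT => A B xA xB; have [||[a b] [[Aa _] [Ba _]]] := H (A `*` setT) (B `*` setT).
  - by exists (A, setT) => //; split=> //; exact: filterT.
  - by exists (B, setT) => //; split=> //; exact: filterT.
  - by exists a.
have -> // : y = y'.
apply: hU => A B yA yB; have [||[a b] [[_ Ab] [_ Bb]]] := H (setT `*` A) (setT `*` B).
- by exists (setT, A) => //; split=> //; exact: filterT.
- by exists (setT, B) => //; split=> //; exact: filterT.
- by exists b.
Qed.

(** * Extension with carriers and subtypes *)

Lemma closed_seq_union (T : topologicalType) (I : eqType) (l : seq I)
    (P : I -> Prop) (t : I -> set T) : (forall k, k \in l -> closed (t k)) ->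
  closed [set x | exists k, [/\ k \in l, P k & t k x]].
Proof.
elim: l => [_|i l IH tc].
  by rewrite (_ : mkset _ = set0) ?eqEsubset; [exact: closed0 | split=> // x []k[]].
have cl : closed [set x | exists k, [/\ k \in l, P k & t k x]].
  by apply: IH => k kl; apply: tc; rewrite in_cons kl orbT.
have [Pi|nPi] := pselect (P i).
  rewrite (_ : mkset _ = t i `|` [set x | exists k, [/\ k \in l, P k & t k x]]).
    by apply: closedU => //; apply: tc; rewrite mem_head.
  rewrite eqEsubset; split=> x.
    case=> k []; rewrite in_cons => /predU1P[-> _ ?|kl Pk tk]; first by left.
    by right; exists k.
  case=> [tx|[k [kl Pk tk]]]; first by exists i; rewrite mem_head.
  by exists k; rewrite in_cons kl orbT.
rewrite (_ : mkset _ = [set x | exists k, [/\ k \in l, P k & t k x]])//.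
rewrite eqEsubset; split=> x [k []].
  by rewrite in_cons => /predU1P[->//|kl Pk tk]; exists k.
by move=> kl Pk tk; exists k; rewrite in_cons kl orbT.
Qed.

(** Constructions run through [l] from its end, so the tail seen by [Q] is what has been treated
    before the entry [i]. *)
Fixpoint along (I : Type) (Q : I -> seq I -> Prop) (l : seq I) : Prop :=
  if l is i :: l' then Q i l' /\ along Q l' else True.

Lemma along_sub (I : eqType) (Q Q' : I -> seq I -> Prop) (l : seq I) :
  (forall i l', i \in l -> {subset l' <= l} -> Q i l' -> Q' i l') ->
  along Q l -> along Q' l.
Proof.
elim: l => //= i l IH QQ' [Qi Ql]; split.
  by apply: QQ' => // [|k kl]; rewrite in_cons ?eqxx// kl orbT.
apply: IH Ql => j l' jl l'l; apply: QQ'; first by rewrite in_cons jl orbT.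
by move=> k /l'l kl; rewrite in_cons kl orbT.
Qed.

(** In [along (face_meet bd t) l], the list [l] enumerates cells by decreasing
    dimension, and [bd i k] reads: [k] is a proper face of [i]. *)
Definition face_meet (T : Type) (I : eqType) (bd : I -> I -> Prop)
    (t : I -> set T) (i : I) (l : seq I) : Prop :=
  forall j x, j \in l -> t i x -> t j x -> exists k, [/\ k \in l, bd i k & t k x].

(** Here [s k] is where the values over the cell [k] end up, and [r i] is where prescribed values
    must lie to be extended over [i]. *)
Definition face_sub (T : Type) (I : eqType) (bd : I -> I -> Prop)
    (s r : I -> set T) (i : I) (l : seq I) : Prop :=
  forall k, k \in l -> bd i k -> s k `<=` r i.

(** The extension property in the definition of an [[L]]-connected pair, for one space [T]. *)
Definition partial_ext (T Y : topologicalType) (V U : set Y) : Prop :=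
  forall (A : set T) (f : T -> Y), closed A -> {within A, continuous f} ->
    (forall x, A x -> V (f x)) -> exists g : T -> Y,
      [/\ continuous g, forall x, U (g x) & forall x, A x -> g x = f x].

(** Extension cell by cell, from the end of [l]. Where [t i] meets an earlier cell it does so in a
    face [k], on which the values lie in [s k] and so in [r i]; on [C] they lie in [r i] by
    hypothesis. Hence the map extends over [t i] with values in [s i]. *)
Lemma carrier_extension (T Y : topologicalType) (I : eqType)
    (bd : I -> I -> Prop) (l : seq I) (t : I -> set T) (r s : I -> set Y)
    (C : set T) (f : T -> Y) :
  closed C -> {within C, continuous f} ->
  (forall i, i \in l -> closed (t i)) ->
  (forall i, i \in l -> partial_ext T (r i) (s i)) ->
  (forall i x, i \in l -> t i x -> C x -> r i (f x)) ->
  along (face_meet bd t) l -> along (face_sub bd s r) l ->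
  exists g : T -> Y, [/\
    {within C `|` [set x | exists2 k, k \in l & t k x], continuous g},
    forall x, C x -> g x = f x & forall k x, k \in l -> t k x -> s k (g x)].
Proof.
move=> cC cf; elim: l => [|i l IH] ct ext rf.
  move=> _ _; exists f; split=> //.
  by apply: continuous_subspaceW cf => x [//|[]].
have il : i \in i :: l by rewrite mem_head.
have ll k : k \in l -> k \in i :: l by rewrite in_cons => ->; rewrite orbT.
case=> ti tl [sri srl]; have [|||g [cg gf gs]] := IH _ _ _ tl srl.
- by move=> k /ll; exact: ct.
- by move=> k /ll; exact: ext.
- by move=> k x /ll; exact: rf.
set B := C `|` _ in cg.
have cB : closed B.
  apply: closedU => //.
  rewrite (_ : mkset _ = [set x | exists k, [/\ k \in l, True & t k x]]).
    by apply: closed_seq_union => k /ll; exact: ct.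
  by rewrite eqEsubset; split=> x; [case=> k|case=> k []]; exists k.
have [|||h [ch hs hg]] := ext i il (t i `&` B) g.
- by apply: closedI => //; exact: ct.
- by apply: continuous_subspaceW cg; exact: subIsetr.
- move=> x [tx [Cx|[j jl tjx]]]; first by rewrite gf//; exact: rf.
  have [k [kl ik tk]] := ti j x jl tx tjx.
  by apply: (sri k kl ik); exact: gs.
pose g' x := if pselect (t i x) then h x else g x.
have g'B x : B x -> g' x = g x.
  by move=> Bx; rewrite /g'; case: pselect => // tx; rewrite hg.
have g't x : t i x -> g' x = h x by rewrite /g'; case: pselect.
exists g'; split.
- rewrite (_ : _ `|` _ = B `|` t i).
    apply: withinU_continuous => //; first exact: ct.
      by apply: eq_within cg => x /g'B ->.
    by apply: eq_within (continuous_subspaceT ch) => x /g't ->.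
  rewrite eqEsubset; split=> x.
    case=> [Cx|[k]]; first by left; left.
    rewrite in_cons => /predU1P[->|kl] tk; first by right.
    by left; right; exists k.
  case=> [[Cx|[k /ll kl tk]]|tx]; [by left| |]; right; last by exists i.
  by exists k.
- by move=> x Cx; rewrite g'B ?gf//; left.
- move=> k x; rewrite in_cons => /predU1P[->|kl] tk; first by rewrite g't.
  by rewrite g'B; [exact: gs | right; exists k].
Qed.

Section Subtype.
Context {W : topologicalType} (N : set W).

Lemma within_set_val (T : topologicalType) (A : set T) (f : T -> N) :
  {within A, continuous (set_val \o f)} -> {within A, continuous f}.
Proof.
move=> /within_openP cf; apply/within_openP => a _ Aa [V oV <-] Va.
exact: (cf a V Aa oV Va).
Qed.

Lemma compact_set_type : compact N -> compact [set: N].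
Proof.
move=> cN F FF _.
have [|p [Np pF]] := cN (set_val @ F) _.
  by apply: (@filterS _ F _ setT) => [x _|]; [exact: set_valP | exact: filterT].
exists (exist _ p (mem_set Np)); split=> // A B FA.
rewrite nbhsE => -[_ [[V oV <-] Vp] VB].
have [] := pF (set_val @` A) V.
- by apply: (@filterS _ F _ A) => // x Ax; exists x.
- exact: open_nbhs_nbhs.
by move=> _ [[x Ax <-] Vx]; exists x; split=> //; exact: VB.
Qed.

(** By [compact_metric_topology], continuity of the functions [d x] suffices for the restricted
    metric to induce the topology of [N]. *)
Lemma compactum_set_type (R : realType) (d : W -> W -> R) :
  compact N -> is_metric d -> (forall x, continuous (d x)) ->
  metrizable_compactum R N.
Proof.
move=> cN [d0 dE dC dD] cd; split; first exact: compact_set_type.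
pose e (x y : N) := d (set_val x) (set_val y).
have em : is_metric e.
  split=> [x y|x y|x y|x y z]; [exact: d0 | | exact: dC | exact: dD].
  split=> [/dE xy|->]; [exact: val_inj | exact: (dE _ _).2].
exists e; split=> //; apply: compact_metric_topology => //.
  exact: compact_set_type.
move=> x y; apply: (@continuous_comp _ _ _ set_val); last exact: cd.
exact: initial_continuous.
Qed.

End Subtype.

(** * Extension dimension of images of closed sets *)

Section Images.
Context {X K L : topologicalType}.
Hypotheses (cX : compact [set: X]) (hK : hausdorff_space K) (LX : AE L X).

Let closed_compact (B : set X) : closed B -> compact B.
Proof. by move=> cB; apply: subclosed_compact cX _. Qed.

Lemma extend_over_image (B : set X) (p : X -> K) (A : set K) (f : K -> L) :
  closed B -> {within B, continuous p} -> {in B &, injective p} ->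
  closed A -> {within A, continuous f} -> exists g : K -> L,
    {within A `|` p @` B, continuous g} /\ forall z, A z -> g z = f z.
Proof.
move=> cB cp pI cA cf.
have cA' : closed (B `&` p @^-1` A) by move/(within_closedP _ cB): cp; apply.
have [|g [cg gf]] := AE_within (f := f \o p) LX cA'.
  apply: (within_comp (B := A)) cf => [x []//|].
  by apply: continuous_subspaceW cp => x [].
pose f' z := if pselect (exists2 x, B x & p x = z) is left e
             then g (s2val (cid2 e)) else f z.
have f'p x : B x -> f' (p x) = g x.
  move=> Bx; rewrite /f'; case: pselect => [e|[]]; last by exists x.
  by case: (cid2 e) => y By /= yx; rewrite (pI y x)//; exact/mem_set.
have f'A z : A z -> f' z = f z.
  move=> Az; rewrite /f'; case: pselect => // e.
  case: (cid2 e) => x Bx /= pxz; rewrite -pxz; apply: gf.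
  by split=> //=; rewrite pxz.
exists f'; split=> //; apply: within_glue_image => //.
- exact: closed_compact.
- by apply: eq_within cf => z /f'A.
- by apply: eq_within (continuous_subspaceT cg) => x Bx /=; rewrite f'p.
Qed.

(** A map is extended first over the image of [B1], then over that of [B2]. *)
Lemma AE_image_cover (y0 : L) (B1 B2 : set X) (p1 p2 : X -> K) :
  closed B1 -> closed B2 ->
  {within B1, continuous p1} -> {within B2, continuous p2} ->
  {in B1 &, injective p1} -> {in B2 &, injective p2} ->
  p1 @` B1 `|` p2 @` B2 = setT -> AE L K.
Proof.
move=> cB1 cB2 cp1 cp2 I1 I2 K12; apply: (within_AE y0) => A f cA cf.
have [g [cg gf]] := extend_over_image cB1 cp1 I1 cA cf.
have cA1 : closed (A `|` p1 @` B1).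
  apply: closedU => //; apply: compact_closed => //.
  by apply: continuous_compact => //; exact: closed_compact.
have [h [ch hg]] := extend_over_image cB2 cp2 I2 cA1 cg.
exists h; split=> [|z Az]; last by rewrite hg ?gf//; left.
rewrite -setUA K12 setUT in ch; exact/withinT.
Qed.

End Images.

(** * Gluing copies of the universal compactum *)

Section UniversalCompactum.
Context {R : realType} {L X : topologicalType}.
Variable l0 : L.
Hypotheses (cX : metrizable_compactum R X) (LX : edim_le X L).
Hypothesis uX : forall K : topologicalType,
  metrizable_compactum R K -> edim_le K L -> embeds K X.
Hypothesis aX : AE_polish R L X.

Let compX : compact [set: X]. Proof. by case: cX. Qed.
Let mX : metrizable R X. Proof. by case: cX. Qed.
Let hX : hausdorff_space X. Proof. exact: metrizable_hausdorff mX. Qed.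
Let XX : AE X X. Proof. by apply: aX => //; exact: compactum_polish. Qed.
Let closed_compact (B : set X) : closed B -> compact B.
Proof. by move=> cB; apply: subclosed_compact compX _. Qed.

(** The subspace [Y] is itself a compactum of extension dimension at most [[L]] (by [AE_image_cover]
    with both pieces equal to [Y]), so universality applies to it. *)
Lemma closed_subspace_embeds (Y : set X) : closed Y -> exists e : X -> X,
  {within Y, continuous e} /\ {in Y &, injective e}.
Proof.
move=> cY; have kY := closed_compact cY.
have [->|/set0P [y0 Yy0]] := eqVneq Y set0.
  exists id; split; last by move=> x y; rewrite in_set0.
  exact: continuous_subspace0.
have mY : metrizable_compactum R Y.
  have [d [dm dT]] := mX; apply: (compactum_set_type (d := d)) => // x.
  exact: metric_continuous.
pose p x : Y := insubd (exist _ y0 (mem_set Yy0) : Y) x.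
have pK x : Y x -> set_val (p x) = x.
  by move=> Yx; apply: (@insubdK _ _ Y); exact: mem_set.
have LY : edim_le Y L.
  have cp : {within Y, continuous p}.
    apply: within_set_val; apply: (eq_within (f := id)) => [x Yx|]; first exact/esym/pK.
    by apply: continuous_subspaceT => x; exact: cvg_id.
  have Ip : {in Y &, injective p}.
    by move=> x y /set_mem Yx /set_mem Yy pxy; rewrite -(pK x)// pxy pK.
  apply: (AE_image_cover compX _ LX l0 cY cY cp cp Ip Ip).
    by case: mY => _; exact: metrizable_hausdorff.
  rewrite setUid eqEsubset; split=> // y _; exists (set_val y).
    exact: set_valP.
  by apply: val_inj; apply: pK; exact: set_valP.
have [e [ce Ie _]] := uX mY LY.
exists (e \o p); split.
  apply: (within_comp (B := setT)) => //; last by apply/withinT.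
  apply: within_set_val; apply: (eq_within (f := id)) => [x Yx|]; first exact/esym/pK.
  by apply: continuous_subspaceT => x; exact: cvg_id.
by move=> x y /set_mem Yx /set_mem Yy /Ie pxy; rewrite -(pK x)// pxy pK.
Qed.

(* The pushout of [B] and [X] along [Y] and an embedding [e] of [Y] into [X]
   sits in [X * X * R]: extend [e] to [e'] and its inverse to [a] (as [X] is an
   absolute extensor for itself), and take the union of the graphs
   [(b, e' b, 0)] and [(a x, x, dist (x, e Y))]. *)
Lemma attach_copy (B Y : set X) : closed B -> closed Y -> Y `<=` B ->
  exists i j : X -> X, [/\ {within B, continuous i}, {in B &, injective i},
    continuous j, injective j &
    (forall b x, B b -> i b = j x -> Y b) /\
    (forall y, Y y -> exists x, j x = i y)].
Proof.
move=> cB cY YB; have [e [ce Ie]] := closed_subspace_embeds cY.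
have [e' [ce' e'E]] := AE_within XX cY ce.
pose E := e @` Y.
have cE : closed E.
  apply: compact_closed => //; apply: continuous_compact => //.
  exact: closed_compact.
have [a0 a0E] : exists a0 : X -> X, forall y, Y y -> a0 (e y) = y.
  exists (fun z => if pselect (exists2 y, Y y & e y = z) is left h
                   then s2val (cid2 h) else z) => y Yy.
  case: pselect => [h|[]]; last by exists y.
  by case: (cid2 h) => y' /= Yy' /Ie -> //; exact/mem_set.
have ca0 : {within E, continuous a0}.
  apply/within_closedP => // C cC.
  rewrite (_ : _ `&` _ = e @` (Y `&` C)).
    apply: compact_closed => //; apply: continuous_compact.
      by apply: continuous_subspaceW ce; exact: subIsetl.
    by apply: closed_compact; exact: closedI.
  rewrite eqEsubset; split=> [_ [[y Yy <-]] /=|_ [y [Yy Cy] <-]].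
    by rewrite a0E// => Cy; exists y.
  by split; [exists y | rewrite /= a0E].
have [a [ca aE]] := AE_within XX cE ca0.
(* The third coordinate makes the two graphs meet only over [E]: a common point has [f x = 0], so
   [x = e y] with [y] in [Y], and then [b = a x = y]. *)
have [f [cf f0 fE]] := metrizable_distance mX cE.
have [d [dm dT]] := mX; have [d0 dE dC dD] := dm.
pose i0 b : X * X * R := (b, e' b, 0); pose j0 x : X * X * R := (a x, x, f x).
have ci0 : continuous i0.
  apply: continuous_pair; last exact: cst_continuous.
  by apply: continuous_pair => // x; exact: cvg_id.
have cj0 : continuous j0.
  apply: continuous_pair => //.
  by apply: continuous_pair => // x; exact: cvg_id.
pose N := i0 @` B `|` range j0.
have kN : compact N.
  apply: compactU; apply: continuous_compact => //.
  - exact: continuous_subspaceT.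
  - exact: closed_compact.
  - exact: continuous_subspaceT.
pose D (u v : X * X * R) := d u.1.1 v.1.1 + d u.1.2 v.1.2 + `|u.2 - v.2|.
have mN : metrizable_compactum R N.
  apply: (compactum_set_type (d := D)) => //.
    split.
    - by move=> u v; rewrite !addr_ge0.
    - move=> [[u1 u2] u3] [[v1 v2] v3]; split=> [|->]; last first.
        by rewrite /D /= !(dE _ _).2// subrr normr0 !addr0.
      rewrite /D /= => D0; have := d0 u1 v1; have := d0 u2 v2.
      have := normr_ge0 (u3 - v3) => n3 n2 n1.
      have /dE -> : d u1 v1 = 0 by lra.
      have /dE -> : d u2 v2 = 0 by lra.
      by have /eqP : `|u3 - v3| = 0 by [lra]; rewrite normr_eq0 subr_eq0 => /eqP ->.
    - by move=> u v; rewrite /D dC (dC u.1.2) distrC.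
    - move=> u v w; rewrite /D.
      have := dD u.1.1 v.1.1 w.1.1; have := dD u.1.2 v.1.2 w.1.2.
      have := ler_distD v.2 u.2 w.2; lra.
  move=> u v; apply: cvgD; first apply: cvgD.
  - apply: (@continuous_comp _ _ _ (fun w : X * X * R => w.1.1)).
      by apply: (@continuous_comp _ _ _ fst fst); exact: cvg_fst.
    exact: metric_continuous.
  - apply: (@continuous_comp _ _ _ (fun w : X * X * R => w.1.2)).
      by apply: (@continuous_comp _ _ _ fst snd); [exact: cvg_fst|exact: cvg_snd].
    exact: metric_continuous.
  - apply: cvg_norm; apply: cvgB; first exact: cvg_cst.
    exact: cvg_snd.
have pN x : (if pselect (B x) then i0 x else j0 x) \in N.
  by apply/mem_set; case: pselect => Bx; [left; exists x | right; exists x].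
have qN x : j0 x \in N by apply/mem_set; right; exists x.
pose p x : N := exist (fun z => z \in N) _ (pN x).
pose q x : N := exist (fun z => z \in N) _ (qN x).
have pE x : B x -> set_val (p x) = i0 x.
  by rewrite -[set_val _]/(if pselect (B x) then _ else _); case: pselect.
have cp : {within B, continuous p}.
  apply: within_set_val; apply: (eq_within (f := i0)) => [x Bx|]; first exact/esym/pE.
  exact: continuous_subspaceT.
have cq : continuous q.
  by apply/withinT; apply: within_set_val; exact/withinT.
have Ip : {in B &, injective p}.
  move=> x y /set_mem Bx /set_mem By /(congr1 set_val).
  by rewrite !pE// => -[].
have Iq : injective q by move=> x y /(congr1 set_val) [].
have LN : edim_le N L.
  apply: (AE_image_cover compX _ LX l0 cB closedT cp _ Ip (in2W Iq)).
  - by case: mN => _; exact: metrizable_hausdorff.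
  - exact/withinT.
  rewrite eqEsubset; split=> // z _.
  case: (set_valP z) => [[b Bb bz]|[x _ xz]]; [left; exists b|right; exists x] => //.
    by apply: val_inj; rewrite -[LHS]/(set_val (p b)) pE.
  exact: val_inj.
have [h [ch Ih _]] := uX mN LN.
exists (h \o p), (h \o q); split.
- by apply: (within_comp (B := setT)) => //; exact/withinT.
- by move=> x y Bx By /Ih; exact: Ip.
- by move=> x; apply: continuous_comp; [exact: cq | exact: ch].
- by move=> x y /Ih /Iq.
split=> [b x Bb /Ih /(congr1 set_val)|y Yy].
  rewrite pE// => -[] /= bax xe fx.
  have /fE [y Yy ex] : f x = 0 by [].
  by rewrite bax -ex aE ?a0E//; exists y.
exists (e y) => /=; congr h; apply: val_inj.
rewrite -[RHS]/(set_val (p y)) pE; last exact: YB.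
rewrite /= /j0 /i0 aE ?a0E ?e'E//; last by exists y.
by rewrite (fE _).2//; exists y.
Qed.

(** As [X] is compact Hausdorff, the continuous injection [j] is an embedding. *)
Definition copy (S : set X) : Prop :=
  exists j : X -> X, [/\ continuous j, injective j & S = range j].

Lemma closed_copy (S : set X) : copy S -> closed S.
Proof.
case=> j [cj _ ->]; apply: compact_closed => //.
by apply: continuous_compact => //; exact: continuous_subspaceT.
Qed.

Lemma copy_image (B S : set X) (i : X -> X) : closed B ->
  {within B, continuous i} -> {in B &, injective i} -> S `<=` B ->
  copy S -> copy (i @` S).
Proof.
move=> cB ci Ii SB [j [cj Ij Sj]].
have Bj x : B (j x) by apply: SB; rewrite Sj; exists x.
exists (i \o j); split.
- apply/withinT; apply: (within_comp (B := B)) ci => //; exact/withinT.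
- by move=> x y /= /Ii ij; apply: Ij; apply: ij; exact: mem_set.
- by rewrite Sj image_comp.
Qed.

(** The inverse of [j] is continuous on the copy since [j] is a closed map, so the extensor property
    of [X] carries over to [S]. *)
Lemma copy_partial_ext (S : set X) (Z : topologicalType) :
  copy S -> polish R Z -> edim_le Z L -> partial_ext Z S S.
Proof.
case=> j [cj Ij ->] pZ LZ A f cA cf fS.
pose k x := if pselect (exists y, j y = x) is left h then sval (cid h) else x.
have jk x : range j x -> j (k x) = x.
  case=> y _ jyx; rewrite /k; case: pselect => [h|[]]; last by exists y.
  exact: svalP (cid h).
have cS : closed (range j) by apply: closed_copy; exists j.
have ck : {within range j, continuous k}.
  apply/within_closedP => // C cC.
  rewrite (_ : _ `&` _ = j @` C).
    apply: compact_closed => //; apply: continuous_compact.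
      exact: continuous_subspaceT.
    exact: closed_compact.
  rewrite eqEsubset; split=> [x [jx Cx]|_ [y Cy <-]].
    by exists (k x) => //; exact: jk.
  split; first by exists y.
  by rewrite /= (Ij (k (j y)) y)// jk//; exists y.
have [|g [cg gf]] := AE_within (f := k \o f) (aX pZ LZ) cA.
  exact: within_comp ck.
exists (j \o g); split=> [x|x|x Ax].
- by apply: continuous_comp; [exact: cg | exact: cj].
- by exists (g x).
- by rewrite /= gf//= jk//; exact: fS.
Qed.

(** Copies of [X] glued together with the face combinatorics prescribed by
    [bd]: each new copy is attached along the union of the copies of its
    faces, which embeds in [X] by universality. *)
Lemma copies_realize (I : eqType) (bd : I -> I -> Prop) (l : seq I) : uniq l ->
  exists s : I -> set X, [/\ forall i, i \in l -> copy (s i),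
    along (face_meet bd s) l & along (face_sub bd s s) l].
Proof.
elim: l => [_|i l IH /= /andP[il ul]]; first by exists (fun=> set0).
have [s [sc sm ss]] := IH ul.
pose B := [set x | exists k, [/\ k \in l, True & s k x]].
pose Y := [set x | exists k, [/\ k \in l, bd i k & s k x]].
have scl k : k \in l -> closed (s k) by move=> /sc; exact: closed_copy.
have cB : closed B by exact: closed_seq_union.
have cY : closed Y by exact: closed_seq_union.
have [|u [v [cu Iu cv Iv [uvY Yv]]]] := attach_copy cB cY.
  by move=> x [k [kl _ sx]]; exists k.
(* The old copies move along with [B] under [u]. By [uvY] the new copy meets them only over faces of
   [i], and by [Yv] it contains the copies of these faces. *)
pose s' k := if k == i then range v else u @` s k.
have s'i : s' i = range v by rewrite /s' eqxx.
have s'k k : k \in l -> s' k = u @` s k.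
  by move=> kl; rewrite /s'; case: eqP => // ki; rewrite ki (negPf il) in kl.
have inB k : k \in l -> s k `<=` B by move=> kl x sx; exists k.
exists s'; split.
- move=> k; rewrite in_cons => /predU1P[->|kl].
    by rewrite s'i; exists v.
  rewrite s'k//; apply: copy_image cu Iu _ _ => //; [exact: inB | exact: sc].
- split.
    move=> j x jl; rewrite s'i s'k// => -[y _ <-] [z sz uz].
    have [k [kl ik kz]] := uvY z y (inB _ jl _ sz) uz.
    by exists k; split=> //; rewrite s'k// -uz; exists z.
  apply: along_sub sm => j l' jl l'l sj k x kl'.
  rewrite !s'k//; last exact: l'l.
  move=> [y sy <-] [z sz uzy].
  have zy : z = y.
    by apply: Iu => //; apply: mem_set; [exact: inB (l'l _ kl') _ sz | exact: inB jl _ sy].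
  rewrite zy in sz; have [m [ml jm my]] := sj k y kl' sy sz.
  by exists m; split=> //; rewrite s'k; [exists y | exact: l'l].
- split.
    move=> k kl ik; rewrite s'i s'k// => _ [y sy <-].
    by have [|x vx] := Yv y; [exists k | exists x].
  apply: along_sub ss => j l' jl l'l sj k kl' jk.
  rewrite !s'k//; last exact: l'l.
  by apply: image_subset; exact: sj.
Qed.

End UniversalCompactum.

(** * Disks and finite unions of cells *)

Local Notation cdisk := (@closedDisk _ _).
Local Notation odisk := (@openDisk _ _).

Section Disk.
Context {R : realType} {n : nat}.
Implicit Types v w : 'rV[R]_n.

(** The squared Euclidean norm, which defines the disks; the norm on row vectors is the maximum
    norm. *)
Definition sqnorm v : R := \sum_(i < n) v ord0 i ^+ 2.

Lemma sqnorm_ge0 v : 0 <= sqnorm v.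
Proof. by apply: sumr_ge0 => i _; exact: sqr_ge0. Qed.

Lemma sqnormZ (a : R) v : sqnorm (a *: v) = a ^+ 2 * sqnorm v.
Proof. by rewrite /sqnorm mulr_sumr; apply: eq_bigr => i _; rewrite mxE exprMn. Qed.

Lemma sqnorm_continuous : continuous sqnorm.
Proof.
suff H (s : seq 'I_n) : continuous (fun v => \sum_(i <- s) v ord0 i ^+ 2) by exact: H.
elim: s => [|i s IH].
  rewrite (_ : (fun v => _) = cst 0); first exact: cst_continuous.
  by apply/funext => v; rewrite big_nil.
rewrite (_ : (fun v => _) =
  (fun v => v ord0 i * v ord0 i + \sum_(i <- s) v ord0 i ^+ 2)).
  move=> v; have vi := @coord_continuous R 1 n ord0 i v.
  exact: cvgD (cvgM vi vi) (IH v).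
by apply/funext => v; rewrite big_cons expr2.
Qed.

Lemma closed_sqnorm_le (r : R) : closed [set v | sqnorm v <= r].
Proof.
apply: (@preimage_closed _ _ sqnorm [set x | x <= r]).
  by move=> v _; exact: sqnorm_continuous.
exact: closed_le.
Qed.

Lemma closed_sqnorm_ge (r : R) : closed [set v | r <= sqnorm v].
Proof.
apply: (@preimage_closed _ _ sqnorm [set x | r <= x]).
  by move=> v _; exact: sqnorm_continuous.
exact: closed_ge.
Qed.

Lemma open_openDisk : open (@openDisk R n).
Proof.
apply: (@open_comp _ _ sqnorm [set x | x < 1]); last exact: open_lt.
by move=> v _; exact: sqnorm_continuous.
Qed.

Lemma compact_closedDisk : compact (@closedDisk R n).
Proof.
apply: bounded_closed_compact; last exact: closed_sqnorm_le.
exists 1; split=> // M M1 v; rewrite /closedDisk /= => v1.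
apply: le_trans (ltW M1); rewrite [leLHS]/Num.Def.normr /= mx_normrE.
apply/bigmax_leP; split=> // -[i j] _ /=; rewrite ord1.
rewrite -(@ler_pXn2r _ 2) ?nnegrE// expr1n real_normK ?num_real//.
apply: le_trans v1; rewrite (bigD1 j)//= lerDl.
by apply: sumr_ge0 => k _; exact: sqr_ge0.
Qed.

Lemma openDisk_closed v : openDisk v -> closedDisk v.
Proof. exact: ltW. Qed.

Lemma closedDiskP v : closedDisk v -> openDisk v \/ sqnorm v = 1.
Proof.
by rewrite /closedDisk /openDisk /= le_eqVlt => /predU1P[|]; [right|left].
Qed.

Lemma closedDisk_sphere v : sqnorm v = 1 -> (cdisk `\` odisk) v.
Proof.
by move=> v1; split; [rewrite /closedDisk /= -/(sqnorm v) v1|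
  rewrite /openDisk /= -/(sqnorm v) v1 ltxx].
Qed.

End Disk.

Section CWBasics.
Context {R : realType} {L : topologicalType} (C : CWcomplex R L).
Local Notation I := (cw_idx C).
Local Notation Phi i := (@cw_map R L C i).
Local Notation supp := (@Defs.support R L C).
Implicit Types (S : set I) (i j : I).

Lemma cw_hausdorff : hausdorff_space L.
Proof. by case: (cw_ax C). Qed.

Lemma cw_map_continuous i : {within cdisk, continuous Phi i}.
Proof. by case: (cw_ax C) => _ []. Qed.

Lemma cw_map_inj i : {in odisk &, injective (Phi i)}.
Proof. by case: (cw_ax C) => _ [_ /(_ i)[]]. Qed.

Lemma cw_map_open i (U : set 'rV[R]_(cw_dim i)) : open U ->
  exists V : set L, open V /\ Phi i @` (U `&` odisk) = V `&` cw_cell i.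
Proof. by case: (cw_ax C) => _ [_ /(_ i)[_ +] _ _ _]; apply. Qed.

Lemma cw_cell_cover x : exists i : I, cw_cell i x.
Proof. by case: (cw_ax C) => _ [_ _ [+ _] _ _]; apply. Qed.

Lemma cw_cell_inj i j x : cw_cell i x -> cw_cell j x -> i = j.
Proof. by case: (cw_ax C) => _ [_ _ [_ +] _ _]; apply. Qed.

Lemma cw_boundary i : exists S, [/\ finite_set S,
  forall j, S j -> (cw_dim j < cw_dim i)%N &
  Phi i @` (cdisk `\` odisk) `<=` supp S].
Proof. by case: (cw_ax C) => _ [_ _ _ + _]; apply. Qed.

(** Finite subcomplexes in a form suited to induction: cells are attached one at a time, each with
    its boundary in what is already there. *)
Inductive built : set I -> Prop :=
| built0 : built set0
| builtU S i : built S -> ~ S i ->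
    Phi i @` (cdisk `\` odisk) `<=` supp S -> built (i |` S).

Lemma supp_sub S S' : S `<=` S' -> supp S `<=` supp S'.
Proof. by move=> SS' x [i /SS' Si ix]; exists i. Qed.

Lemma suppU1 S i : Phi i @` (cdisk `\` odisk) `<=` supp S ->
  supp (i |` S) = supp S `|` Phi i @` cdisk.
Proof.
move=> bS; rewrite eqEsubset; split=> x.
  case=> j [->|Sj] jx; last by left; exists j.
  by right; case: jx => v /openDisk_closed Dv <-; exists v.
case=> [[j Sj jx]|[v Dv vx]]; first by exists j => //; right.
have [ov|nov] := pselect (openDisk v).
  by exists i; [left | exists v].
have [|j Sj jx] := bS x; first by exists v.
by exists j => //; right.
Qed.

Lemma compact_closed_cell i : compact (Phi i @` cdisk).
Proof.
by apply: continuous_compact; [exact: cw_map_continuous|exact: compact_closedDisk].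
Qed.

Lemma built_compact S : built S -> compact (supp S).
Proof.
elim=> [|{}S i _ IH _ bS]; first by rewrite /Defs.support bigcup_set0; exact: compact0.
by rewrite suppU1//; apply: compactU => //; exact: compact_closed_cell.
Qed.

Lemma built_finite_subcomplex S : built S -> finite_subcomplex S.
Proof.
elim=> [|{}S i _ [sS fS] _ bS]; first by split=> //; move=> j [].
split; last by rewrite finite_setU; split=> //; exact: finite_set1.
move=> j; rewrite -/(supp _) suppU1// => -[->|Sj]; first by move=> x; right.
by move=> x /(sS j Sj); left.
Qed.

Lemma built_union S S' : built S -> built S' -> built (S `|` S').
Proof.
move=> + bS'; elim=> [|{}S i _ IH _ bS]; first by rewrite set0U.
rewrite -setUA; have [Si|nSi] := pselect ((S `|` S') i).
  rewrite (_ : [set i] `|` (S `|` S') = S `|` S')// eqEsubset.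
  by split=> [j [->|]//|j]; right.
apply: builtU => //; apply: subset_trans bS _.
by apply: supp_sub => j; left.
Qed.

Lemma built_of_finite (F : set I) : finite_set F ->
  (forall i, F i -> exists S, built S /\ S i) -> exists S, built S /\ F `<=` S.
Proof.
move=> /(@finite_seqP {classic I})[s ->]; elim: s => [_|i s IH H].
  by exists set0; split=> //; exact: built0.
have [|S [bS sS]] := IH; first by move=> j js; apply: H; rewrite /= in_cons js orbT.
have [|S' [bS' S'i]] := H i; first by rewrite /= mem_head.
exists (S' `|` S); split; first exact: built_union.
by move=> j; rewrite /= in_cons => /predU1P[->|/sS]; [left|right].
Qed.

(** Induction on the dimension: the boundary of a cell lies in finitely many cells of lower
    dimension. *)
Lemma built_cell i : exists S, built S /\ S i.
Proof.
have [m] := ubnP (cw_dim i); elim: m i => // m IH i im.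
have [F [fF dF bF]] := cw_boundary i.
have [|S [bS FS]] := built_of_finite fF.
  by move=> j /dF ji; apply: IH; exact: leq_trans ji _.
have [Si|nSi] := pselect (S i); first by exists S.
exists (i |` S); split; last by left.
by apply: builtU => //; apply: subset_trans bF _; exact: supp_sub.
Qed.

Lemma built_finite (F : set I) : finite_set F -> exists S, built S /\ F `<=` S.
Proof. by move=> fF; apply: built_of_finite => // i _; exact: built_cell. Qed.

(** Finitely many neighbourhoods, each meeting finitely many closed cells, cover [K]; [S] collects
    all these cells. *)
Lemma compact_built_nbhs (K : set L) : cw_locally_finite C -> compact K ->
  exists O S, [/\ open O, K `<=` O, built S & O `<=` supp S].
Proof.
move=> lf cK; have [U UP] := choice lf.
have [|F [_ KF]] := compact_finite_subcover (U := U) cK.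
  by move=> x _; have [oU Ux _] := UP x; exact: open_nbhs_nbhs.
pose O := \bigcup_(y in [set` F]) U y.
pose N := \bigcup_(y in [set` F]) [set i : I | cw_closed_cell i `&` U y !=set0].
have [|S [bS NS]] := @built_finite N.
  by apply: bigcup_finite => // y _; case: (UP y).
exists O, S; split=> //.
  by apply: bigcup_open => y _; case: (UP y).
move=> x [y Fy Uyx]; have [i ix] := cw_cell_cover x.
exists i => //; apply: NS; exists y => //; exists x; split=> //.
by case: ix => v /openDisk_closed Dv <-; exists v.
Qed.

End CWBasics.

(** * Attaching a cell *)

Lemma compact_tietze (R : realType) (X : pseudoMetricType R) (A : set X)
    (f : X -> R) : closed A -> compact A -> {within A, continuous f} ->
  exists g : X -> R, continuous g /\ forall x, A x -> g x = f x.
Proof.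
move=> cA kA cf.
have kfA : compact (f @` A : set R^o) by exact: continuous_compact.
have [M [_ MP]] := compact_bounded kfA.
(* The bound has to exceed [M] strictly and to be positive. *)
pose N := Num.max M 0 + 1.
have N0 : 0 < N by rewrite ltr_wpDl// le_max lexx orbT.
have MN : M < N by rewrite ltr_pwDr// le_max lexx.
have [|g [gf cg _]] :=
    continuous_bounded_extension (@pseudometric_normal R X) cA (f := f) N0 cf.
  by move=> x Ax; apply: (MP _ MN); exists x.
by exists g; split=> // x Ax; rewrite gf//; exact/mem_set.
Qed.

Section AttachedCell.
Context {R : realType} {L : topologicalType} (C : CWcomplex R L).
Local Notation I := (cw_idx C).
Local Notation Phi i := (@cw_map R L C i).
Local Notation supp := (@Defs.support R L C).
Variables (S : set I) (i : I).
Hypotheses (bS : built S) (nSi : ~ S i).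
Hypothesis bd : Phi i @` (cdisk `\` odisk) `<=` supp S.
Implicit Types (v w : 'rV[R]_(cw_dim i)) (z : L).

Lemma open_cell_disjoint v : odisk v -> ~ supp S (Phi i v).
Proof.
move=> ov [j Sj jv]; apply: nSi; rewrite (@cw_cell_inj _ _ _ i j (Phi i v))//.
by exists v.
Qed.

Lemma sphere_base v : sqnorm v = 1 -> supp S (Phi i v).
Proof. by move=> v1; apply: bd; exists v => //; exact: closedDisk_sphere. Qed.

(** Inverse of the characteristic map on the open cell. *)
Definition cell_coord z : 'rV[R]_(cw_dim i) :=
  if pselect (exists2 v, odisk v & Phi i v = z) is left e then s2val (cid2 e)
  else 0.

Lemma cell_coordK v : odisk v -> cell_coord (Phi i v) = v.
Proof.
move=> ov; rewrite /cell_coord; case: pselect => [e|[]]; last by exists v.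
by case: (cid2 e) => w ow /= wv; apply: (@cw_map_inj _ _ C i) => //; exact/mem_set.
Qed.

Lemma cell_coord_continuous : {within cw_cell i, continuous cell_coord}.
Proof.
apply/within_openP => z W [v ov <-] oW; rewrite cell_coordK// => Wv.
have [V [oV VE]] := cw_map_open oW.
have : (V `&` cw_cell i) (Phi i v) by rewrite -VE; exists v.
case=> Vv _; exists V; split=> // z' iz' Vz'.
have : (V `&` cw_cell i) z' by [].
by rewrite -VE => -[w [Ww ow] <-]; rewrite cell_coordK.
Qed.

Lemma suppU1_cases z : supp (i |` S) z ->
  supp S z \/ exists2 v, odisk v & Phi i v = z.
Proof.
rewrite suppU1// => -[|[v /closedDiskP[ov|v1] <-]]; [by left|right|left].
  by exists v.
exact: sphere_base.
Qed.

Lemma closed_base : closed (supp S).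
Proof. by apply: compact_closed; [exact: (cw_hausdorff C) | exact: built_compact]. Qed.

(** The map on the adjunction space of base and cell that [a] and [b] determine when they agree on
    the sphere. *)
Definition cell_fun (T : Type) (a : L -> T) (b : 'rV[R]_(cw_dim i) -> T) z : T :=
  if pselect (supp S z) then a z else b (cell_coord z).

Lemma cell_fun_base (T : Type) (a : L -> T) b z :
  supp S z -> cell_fun a b z = a z.
Proof. by rewrite /cell_fun; case: pselect. Qed.

Lemma cell_fun_cell (T : Type) (a : L -> T) b v :
  (forall w, sqnorm w = 1 -> a (Phi i w) = b w) -> cdisk v ->
  cell_fun a b (Phi i v) = b v.
Proof.
move=> ab /closedDiskP[ov|v1]; last first.
  by rewrite cell_fun_base ?ab//; exact: sphere_base.
rewrite /cell_fun; case: pselect => [Yv|nYv] /=; last by rewrite cell_coordK.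
by case: (open_cell_disjoint ov).
Qed.

Lemma cell_fun_continuous (T : topologicalType) (a : L -> T) b :
  {within supp S, continuous a} -> {within cdisk, continuous b} ->
  (forall w, sqnorm w = 1 -> a (Phi i w) = b w) ->
  {within supp (i |` S), continuous (cell_fun a b)}.
Proof.
move=> ca cb ab; rewrite suppU1//; apply: within_glue_image.
- exact: (cw_hausdorff C).
- exact: compact_closedDisk.
- exact: cw_map_continuous.
- exact: closed_base.
- by apply: eq_within ca => z Yz; rewrite cell_fun_base.
- by apply: eq_within cb => v Dv /=; rewrite cell_fun_cell.
Qed.

End AttachedCell.

(** Induction on the cells. The old coordinates extend over the new disk by Tietze. The new ones are
    [1 - |v|^2] and its products with the coordinates of [v]; they vanish on the sphere and are
    extended by 0. The first is nonzero exactly on the open cell, and dividing by it recovers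
    [v]. *)
Lemma built_embedding (R : realType) (L : topologicalType) (C : CWcomplex R L)
    (S : set (cw_idx C)) : built S ->
  exists (J : finType) (psi : J -> L -> R),
    (forall j, {within Defs.support S, continuous (psi j)}) /\
    forall x y, Defs.support S x -> Defs.support S y ->
      (forall j, psi j x = psi j y) -> x = y.
Proof.
elim=> [|{}S i bS [J [psi [cpsi Ipsi]]] nSi bd].
  by exists void, (fun=> fun=> 0); split=> [[]|x y []].
have ext j : exists b : 'rV[R]_(cw_dim i) -> R,
    continuous b /\ forall v, sqnorm v = 1 -> b v = psi j (@cw_map R L C i v).
  pose A := [set v : 'rV[R]_(cw_dim i) | sqnorm v = 1].
  have AE : A = cdisk `&` [set v | 1 <= sqnorm v].
    rewrite eqEsubset; split=> v /=; rewrite /A /closedDisk /= -/(sqnorm v).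
      by move=> ->.
    by case=> v1 v1'; apply/eqP; rewrite eq_le; apply/andP.
  have kA : compact A.
    rewrite AE; apply: compact_closedI; first exact: compact_closedDisk.
    exact: closed_sqnorm_ge.
  have cA : closed A by apply: compact_closed kA; exact: norm_hausdorff.
  have [|b [cb bE]] := compact_tietze (f := psi j \o @cw_map R L C i) cA kA.
    apply: within_comp (cpsi j) => [v v1|]; first exact: sphere_base.
    apply: continuous_subspaceW (@cw_map_continuous _ _ C i).
    by rewrite AE; exact: subIsetl.
  by exists b.
have [b bP] := choice ext.
pose new (k : option 'I_(cw_dim i)) (v : 'rV[R]_(cw_dim i)) : R :=
  (1 - sqnorm v) * (if k is Some m then v ord0 m else 1).
have cnew k : continuous (new k).
  move=> v; have sv := @sqnorm_continuous R _ v.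
  case: k => [m|].
    exact: cvgM (cvgB (cvg_cst (1 : R)) sv) (@coord_continuous _ _ _ ord0 m v).
  exact: cvgM (cvgB (cvg_cst (1 : R)) sv) (cvg_cst (1 : R)).
pose psi' (j : J + option 'I_(cw_dim i)) : L -> R :=
  match j with inl j => cell_fun S (psi j) (b j)
             | inr k => cell_fun S (fun=> 0) (new k) end.
have bE j v : sqnorm v = 1 -> psi j (@cw_map R L C i v) = b j v.
  by move=> v1; rewrite (bP j).2.
have nE k v : sqnorm v = 1 -> 0 = new k v by rewrite /new => ->; rewrite subrr mul0r.
exists (J + option 'I_(cw_dim i))%type, psi'; split.
  move=> [j|k] /=; apply: cell_fun_continuous => //.
  - by apply: continuous_subspaceT; case: (bP j).
  - by move=> v; exact: bE.
  - by apply: continuous_subspaceT; exact: cst_continuous.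
  - exact: continuous_subspaceT.
  - by move=> v; exact: nE.
have None0 v : openDisk v -> psi' (inr None) (@cw_map R L C i v) != 0.
  move=> ov; rewrite /= cell_fun_cell//; last first.
  - exact: openDisk_closed.
  - by move=> w; exact: nE.
  by rewrite /new mulr1 subr_eq0 gt_eqF.
move=> x y /suppU1_cases-/(_ bd)[Yx|[v ov <-]] /suppU1_cases-/(_ bd)[Yy|[w ow <-]] E.
- by apply: Ipsi => // j; have := E (inl j); rewrite /= !cell_fun_base.
- by have /eqP := None0 w ow; rewrite -E /= cell_fun_base.
- by have /eqP := None0 v ov; rewrite E /= cell_fun_base.
- have Ek k : new k v = new k w.
    have := E (inr k); rewrite /= !cell_fun_cell//; try exact: openDisk_closed.
    + by move=> u; exact: nE.
    + by move=> u; exact: nE.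
  have vw : sqnorm v = sqnorm w by have := Ek None; rewrite /new; lra.
  have w1 : 1 - sqnorm w != 0 by rewrite subr_eq0 gt_eqF.
  congr cw_map; apply/rowP => m; apply: (mulfI w1).
  by have := Ek (Some m); rewrite /new vw.
Qed.

(** * Local contractibility *)

(** [V `&` K] is contractible in [U], tested on maps [f] into [V `&` K] with a
    time function [u]: they carry concatenations without products of spaces. *)
Definition contracts (R : realType) (L : topologicalType) (K V U : set L) :=
  exists2 x0 : L, U x0 & forall (T : topologicalType) (G : set T) (f : T -> L)
    (u : T -> R), closed G -> {within G, continuous f} ->
    {within G, continuous u} -> (forall z, G z -> K (f z) /\ V (f z)) ->
    exists F : T -> L, {within G, continuous F} /\
      forall z, G z -> [/\ U (F z), u z <= 0 -> F z = f z & 1 <= u z -> F z = x0].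

Definition clamp (R : realType) (x : R) : R := Num.max 0 (Num.min 1 x).

Section Clamp.
Context {R : realType}.
Implicit Types x : R.

Lemma clamp_itv x : 0 <= clamp x <= 1.
Proof. by rewrite le_max lexx ge_max ler01 ge_min lexx. Qed.

Lemma clamp_le0 x : x <= 0 -> clamp x = 0.
Proof. by move=> x0; rewrite /clamp max_l// ge_min x0 orbT. Qed.

Lemma clamp_ge1 x : 1 <= x -> clamp x = 1.
Proof. by move=> x1; rewrite /clamp min_l// max_r. Qed.

Lemma clamp_continuous : continuous (@clamp R).
Proof.
have c1 : continuous (fun x : R => Num.min 1 x).
  by move=> x; exact: (@continuous_min R R (cst 1) id x (cvg_cst _) cvg_id).
by move=> x; exact: (@continuous_max R R (cst 0) _ x (cvg_cst _) (c1 x)).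
Qed.

End Clamp.

Section Radial.
Context {R : realType} {n : nat}.
Implicit Types v : 'rV[R]_n.

(** For nonzero [v], the straight path from [v] to its projection [v / |v|] on the sphere. *)
Definition radial v (s : R) := (1 - s + s / Num.sqrt (sqnorm v)) *: v.

Lemma radial0 v : radial v 0 = v.
Proof. by rewrite /radial mul0r addr0 subr0 scale1r. Qed.

Lemma radial_sphere v s : sqnorm v = 1 -> radial v s = v.
Proof. by move=> v1; rewrite /radial v1 sqrtr1 divr1 subrK scale1r. Qed.

Lemma sqnorm_radial v s : 0 < sqnorm v ->
  sqnorm (radial v s) = ((1 - s) * Num.sqrt (sqnorm v) + s) ^+ 2.
Proof.
move=> v0; rewrite sqnormZ -[X in _ * X]sqr_sqrtr ?sqnorm_ge0// -exprMn.
by rewrite mulrDl divfK// gt_eqF// sqrtr_gt0.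
Qed.

Lemma radial_closedDisk v s : 0 < sqnorm v -> 0 <= s <= 1 ->
  closedDisk v -> closedDisk (radial v s).
Proof.
move=> v0 /andP[s0 s1] Dv; rewrite /closedDisk /= -/(sqnorm _) sqnorm_radial//.
have n0 := sqrtr_ge0 (sqnorm v).
have n1 : Num.sqrt (sqnorm v) <= 1 by rewrite -sqrtr1; exact: ler_wsqrtr.
by rewrite expr_le1//; nra.
Qed.

Lemma radial_continuous : {in [set vs : 'rV[R]_n * R | 0 < sqnorm vs.1],
  continuous (fun vs => radial vs.1 vs.2)}.
Proof.
move=> [v s] /set_mem /= v0.
have c1 : (fun vs : 'rV[R]_n * R => vs.1) @ (v, s) --> v by exact: cvg_fst.
have c2 : (fun vs : 'rV[R]_n * R => vs.2) @ (v, s) --> s by exact: cvg_snd.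
have cn : (fun vs : 'rV[R]_n * R => (Num.sqrt (sqnorm vs.1))^-1) @ (v, s) -->
    (Num.sqrt (sqnorm v))^-1.
  apply: cvgV; first by rewrite gt_eqF// sqrtr_gt0.
  apply: (cvg_comp (fun vs : 'rV[R]_n * R => sqnorm vs.1)); last exact: sqrt_continuous.
  by apply: cvg_comp c1 _; exact: sqnorm_continuous.
exact: cvgZ (cvgD (cvgB (cvg_cst (1 : R)) c2) (cvgM c2 cn)) c1.
Qed.

End Radial.

Section Contraction.
Context {R : realType} {L : topologicalType} (C : CWcomplex R L).
Local Notation I := (cw_idx C).
Local Notation Phi i := (@cw_map R L C i).
Local Notation supp := (@Defs.support R L C).

Section Cell.
Variables (S : set I) (i : I).
Hypotheses (bS : built S) (nSi : ~ S i).
Hypothesis bd : Phi i @` (cdisk `\` odisk) `<=` supp S.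

(** Radial push of the cell, minus its centre, into the base. Continuity is needed only on [collar],
    where disk points have norm at least 1/2, away from the division by zero. *)
Definition collapse (zs : L * R) : L :=
  cell_fun S id (fun v => Phi i (radial v zs.2)) zs.1.

Let collar := supp S `|` Phi i @` (cdisk `&` [set v | 4^-1 <= sqnorm v]).

Lemma collapse_base z s : supp S z -> collapse (z, s) = z.
Proof. exact: cell_fun_base. Qed.

Lemma collapse_cell v s : cdisk v -> collapse (Phi i v, s) = Phi i (radial v s).
Proof.
move=> Dv; rewrite /collapse /= cell_fun_cell// => w w1.
by rewrite radial_sphere.
Qed.

Lemma collapse0 z : supp (i |` S) z -> collapse (z, 0) = z.
Proof.
move=> /(suppU1_cases bd)[/collapse_base ->//|[v /openDisk_closed Dv <-]].
by rewrite collapse_cell// radial0.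
Qed.

Lemma collapse1 z : collar z -> supp S (collapse (z, 1)).
Proof.
case=> [Yz|[v [Dv v4] <-]]; first by rewrite collapse_base.
have v0 : 0 < sqnorm v by apply: lt_le_trans v4.
rewrite collapse_cell//; apply: sphere_base => //.
by rewrite sqnorm_radial// subrr mul0r add0r expr1n.
Qed.

Lemma collapse_continuous : {within collar `*` `[0, 1], continuous collapse}.
Proof.
pose D := (cdisk `&` [set v : 'rV[R]_(cw_dim i) | 4^-1 <= sqnorm v]) `*`
  `[(0 : R), 1]%classic.
pose p (vs : 'rV[R]_(cw_dim i) * R) := (Phi i vs.1, vs.2).
rewrite (_ : _ `*` _ = (supp S `*` `[0, 1]) `|` p @` D); last first.
  rewrite eqEsubset; split=> [[z s] /= [[Yz|[v Dv <-]] s01]|[z s]].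
  - by left.
  - by right; exists (v, s).
  by case=> [[Yz s01]|[[v s'] [Dv s01] [<- <-]]]; split => //; [left|right; exists v].
have cp : {within D, continuous p}.
  apply: continuous_pair; last first.
    by apply: continuous_subspaceT => vs; exact: cvg_snd.
  apply: (within_comp (B := cdisk)); last exact: cw_map_continuous.
    by case=> v s [[]].
  by apply: continuous_subspaceT => vs; exact: cvg_fst.
apply: within_glue_image => //.
- apply: hausdorff_pair; [exact: (cw_hausdorff C) | exact: Rhausdorff].
- apply: compact_setX; last exact: segment_compact.
  by apply: compact_closedI; [exact: compact_closedDisk | exact: closed_sqnorm_ge].
- apply: compact_closed.
    by apply: hausdorff_pair; [exact: (cw_hausdorff C) | exact: Rhausdorff].
  by apply: compact_setX; [exact: built_compact | exact: segment_compact].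
- apply: (eq_within (f := fst)) => [[z s] [Yz _]|]; first by rewrite collapse_base.
  by apply: continuous_subspaceT => zs; exact: cvg_fst.
- apply: (eq_within (f := Phi i \o (fun vs => radial vs.1 vs.2))).
    by case=> v s [[Dv _] _] /=; rewrite collapse_cell.
  apply: (within_comp (B := cdisk)); last exact: cw_map_continuous.
    case=> v s [[Dv v4] s01] /=; apply: radial_closedDisk => //.
    exact: lt_le_trans v4.
  apply: continuous_in_subspaceT => -[v s] /set_mem [[Dv v4] s01].
  by apply: radial_continuous; apply/mem_set; apply: lt_le_trans v4.
Qed.

(** Points near [x] are first pushed radially into the base, within [U] and ending in [V], and then
    follow the contraction available in the base. *)
Lemma contract_at_base x (U : set L) (V : set L) : supp S x -> open U -> U x ->
  open V -> V x -> contracts R (supp S) V U ->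
  exists W, [/\ open W, W x & contracts R (supp (i |` S)) W U].
Proof.
move=> Yx oU Ux oV Vx [x0 Ux0 VU].
(* Tube lemma: [x] is fixed by the push, and the time interval is compact. *)
have tube (O : set L) : open O -> O x -> \forall z \near x,
    `[(0 : R), 1]%classic `<=` [set s | collar z -> O (collapse (z, s))].
  move=> oO Ox.
  have /compact_near_coveringP/near_covering_withinP := @segment_compact R 0 1.
  apply=> s s01.
  have /within_openP/(_ (x, s) O) := collapse_continuous.
  rewrite collapse_base// => -[|//|//|B [oB Bxs BO]]; first by split=> //; left.
  have : nbhs (x, s) B by exact: open_nbhs_nbhs.
  case=> -[B1 B2] /= [xB1 sB2] BB; exists (B2, B1) => // -[s' z] [B2s B1z] /= s'01 cz.
  by apply: BO => //; apply: (BB (z, s')).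
(* The inner disk of radius 1/2 has compact image in the open cell, which misses the base; points
   off it lie in the collar. *)
have nb : \forall z \near x, ~ (Phi i @` (cdisk `&` [set v | sqnorm v <= 4^-1])) z.
  apply: open_nbhs_nbhs; split.
    apply: closed_openC; apply: compact_closed; first exact: (cw_hausdorff C).
    apply: continuous_compact.
      by apply: continuous_subspaceW (@cw_map_continuous _ _ C i); exact: subIsetl.
    by apply: compact_closedI; [exact: compact_closedDisk|exact: closed_sqnorm_le].
  case=> v [Dv v4] vx; apply: (@open_cell_disjoint _ _ _ S i nSi v).
    by rewrite /openDisk /= -/(sqnorm v); apply: le_lt_trans v4 _; lra.
  by rewrite vx.
have : nbhs x [set z | [/\ ~ (Phi i @` (cdisk `&` [set v | sqnorm v <= 4^-1])) z,
    `[(0 : R), 1]%classic `<=` [set s | collar z -> U (collapse (z, s))] &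
    `[(0 : R), 1]%classic `<=` [set s | collar z -> V (collapse (z, s))]]].
  by apply: filterS3 nb (tube U oU Ux) (tube V oV Vx) => z ? ? ?.
rewrite nbhsE => -[W [oW Wx] WP]; exists W; split=> //; exists x0 => //.
move=> T G f u cG cf cu fKW.
have fc z : G z -> collar (f z).
  move=> /fKW [Kf /WP [nf _ _]].
  have [Yf|[v ov vf]] := suppU1_cases bd Kf; [by left | right; exists v => //].
  have Dv := openDisk_closed ov.
  split=> //=; rewrite leNgt; apply/negP => v4; apply: nf; exists v => //.
  by split=> //; exact: ltW.
(* The push runs at double speed while [u <= 1/2], the contraction in the base while [u >= 1/2]; at
   [u = 1/2] both give [f2]. *)
pose c z := clamp (2 * u z); pose F1 z := collapse (f z, c z).
have cU z : 0 <= c z <= 1 by exact: clamp_itv.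
have cc : {within G, continuous c}.
  move=> z; apply: (@continuous_comp (subspace G) _ _ (fun z => 2 * u z)).
    by apply: cvgM; [exact: cvg_cst | exact: cu].
  exact: clamp_continuous.
have cF1 : {within G, continuous F1}.
  apply: (within_comp (f := fun z => (f z, c z))) collapse_continuous.
    by move=> z Gz; split; [exact: fc | rewrite /= in_itv /=; exact: cU].
  exact: continuous_pair.
pose f2 z := collapse (f z, 1).
have cf2 : {within G, continuous f2}.
  apply: (within_comp (f := fun z => (f z, 1 : R))) collapse_continuous.
    by move=> z Gz; split; [exact: fc | rewrite /= in_itv /= ler01 lexx].
  by apply: continuous_pair => // z; exact: cvg_cst.
have clG (D : set R) : closed D -> closed (G `&` u @^-1` D).
  by move/(within_closedP _ cG): cu; apply.
have cG1 := clG _ (@closed_le R 2^-1).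
have cG2 := clG _ (@closed_ge R 2^-1).
have [||||F2 [cF2 F2P]] := VU T (G `&` u @^-1` [set x | 2^-1 <= x]) f2
    (fun z => 2 * u z - 1).
- exact: cG2.
- by apply: continuous_subspaceW cf2; exact: subIsetl.
- apply: continuous_subspaceW (@subIsetl _ _ _) _ => z.
  apply: cvgB; last exact: cvg_cst.
  by apply: cvgM; [exact: cvg_cst | exact: cu].
- move=> z [Gz _]; split; first by apply: collapse1; exact: fc.
  have [_ /WP [_ _ h]] := fKW z Gz; apply: h (fc z Gz).
  by rewrite /= in_itv /= ler01 lexx.
pose F z := if u z <= 2^-1 then F1 z else F2 z.
have FE1 z : u z <= 2^-1 -> F z = F1 z by rewrite /F => ->.
have FE2 z : G z -> 2^-1 <= u z -> F z = F2 z.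
  move=> Gz uz; rewrite /F; case: ifPn => // uz'.
  have uE : u z = 2^-1 by apply/eqP; rewrite eq_le uz uz'.
  have [_ h _] := F2P z (conj Gz uz); rewrite h; last by rewrite uE; lra.
  by rewrite /F1 /c uE divff ?clamp_ge1.
exists F; split.
  rewrite (_ : G = (G `&` u @^-1` [set x | x <= 2^-1]) `|`
                   (G `&` u @^-1` [set x | 2^-1 <= x])); last first.
    rewrite -setIUr eqEsubset; split=> z => [Gz|[]//]; split=> //=.
    by case: (leP (u z) 2^-1) => [|/ltW]; [left|right].
  apply: withinU_continuous => //.
    apply: (eq_within (f := F1)) => [z [_ /FE1 ->//]|].
    by apply: continuous_subspaceW cF1; exact: subIsetl.
  by apply: (eq_within (f := F2)) => // z [Gz uz]; rewrite FE2.
move=> z Gz; have [Kf Wf] := fKW z Gz; have [_ UP _] := WP _ Wf.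
split.
- have [uz|/ltW uz] := leP (u z) 2^-1; last first.
    by rewrite FE2//; have [] := F2P z (conj Gz uz).
  by rewrite FE1//; apply: UP (fc z Gz); rewrite /= in_itv /=; exact: cU.
- move=> u0; rewrite FE1; last by lra.
  by rewrite /F1 /c clamp_le0 ?collapse0//; lra.
- move=> u1; have uz : 2^-1 <= u z by lra.
  by rewrite FE2//; have [_ _ h] := F2P z (conj Gz uz); apply: h; lra.
Qed.

(** In disk coordinates this is the straight-line homotopy to [v0], which stays in a ball by
    convexity. Removing the base from the neighbourhood leaves only points of the open cell. *)
Lemma contract_at_cell x (U : set L) : cw_cell i x -> open U -> U x ->
  exists W, [/\ open W, W x & contracts R (supp (i |` S)) W U].
Proof.
move=> [v0 ov0 <-] oU Uv0.
have /within_openP/(_ v0 U (openDisk_closed ov0) oU Uv0) :=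
  @cw_map_continuous _ _ C i.
case=> B [oB Bv0 BU].
have : nbhs v0 (B `&` odisk).
  by apply: open_nbhs_nbhs; split=> //; apply: openI => //; exact: open_openDisk.
rewrite -nbhs_ballE => -[e /= e0 eB].
have [V [oV VE]] := cw_map_open (i := i) (ball_open v0 e).
have Vv0 : V (Phi i v0).
  have [] : (V `&` cw_cell i) (Phi i v0) by rewrite -VE; exists v0 => //; split=> //; exact: ballxx.
  by [].
exists (V `&` ~` supp S); split.
- by apply: openI => //; apply: closed_openC; exact: closed_base.
- by split=> //; exact: open_cell_disjoint.
exists (Phi i v0) => // T G f u cG cf cu fKV.
have cell_f z : G z -> exists w, [/\ ball v0 e w, odisk w & Phi i w = f z].
  move=> /fKV [Kf [Vf nYf]]; have [//|[w ow wf]] := suppU1_cases bd Kf.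
  have : (V `&` cw_cell i) (f z) by split=> //; exists w.
  by rewrite -VE => -[w' [bw' ow'] wf']; exists w'.
pose g z := cell_coord i (f z).
have cg : {within G, continuous g}.
  apply: within_comp (cf) (cell_coord_continuous (i := i)).
  by move=> z /cell_f [w [_ ow <-]]; exists w.
pose c z := clamp (u z).
have cc : {within G, continuous c}.
  move=> z; apply: (@continuous_comp (subspace G) _ _ u); first exact: cu.
  exact: clamp_continuous.
pose h z := (1 - c z) *: g z + c z *: v0.
have hB z : G z -> (B `&` odisk) (h z).
  move=> Gz; have [w [bw ow wf]] := cell_f z Gz.
  apply: eB; rewrite /h /g -wf cell_coordK// -ball_normE /=.
  have /andP[c0 c1] := clamp_itv (u z).
  rewrite (_ : v0 - _ = (1 - c z) *: (v0 - w)); last first.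
    by apply/rowP => k; rewrite !mxE; ring.
  rewrite normrZ ger0_norm ?subr_ge0//.
  move: bw; rewrite -ball_normE /= => bw; have := normr_ge0 (v0 - w).
  by rewrite -/(c z) in c0 c1 *; nra.
exists (Phi i \o h); split.
  apply: (within_comp (B := cdisk)); last exact: cw_map_continuous.
    by move=> z /hB[_] /openDisk_closed.
  move=> z; apply: cvgD.
    by apply: cvgZ; [apply: cvgB; [exact: cvg_cst | exact: cc] | exact: cg].
  by apply: cvgZ; [exact: cc | exact: cvg_cst].
move=> z Gz; have [Bh oh] := hB z Gz; split.
- by apply: BU => //; exact: openDisk_closed.
- move=> u0; rewrite /= /h /c clamp_le0// subr0 scale1r scale0r addr0 /g.
  by have [w [_ ow <-]] := cell_f z Gz; rewrite cell_coordK.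
- by move=> u1; rewrite /= /h /c clamp_ge1// subrr scale0r scale1r add0r.
Qed.

End Cell.

Lemma built_contraction (S : set I) : built S ->
  forall x (U : set L), supp S x -> open U -> U x ->
  exists V, [/\ open V, V x & contracts R (supp S) V U].
Proof.
elim=> [x U []//|{}S i bS IH nSi bd x U].
move=> /(suppU1_cases bd)[Yx|[v ov <-]] oU Ux.
  have [V [oV Vx VU]] := IH x U Yx oU Ux.
  exact: contract_at_base VU.
by apply: contract_at_cell => //; exists v.
Qed.

(** Extend [f] to [f'] with values in [L], which is good only near [A]. A Urysohn function [u]
    serves as time: [f'] is contracted while [u <= 1/2], reaches [x0] at [u = 1/2], and is replaced
    by [x0] beyond. *)
Lemma local_extension (x : L) (U : set L) : cw_locally_finite C ->
  open U -> U x -> exists V : set L, [/\ open V, V x &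
    forall T : topologicalType, metrizable R T -> AE L T -> partial_ext T V U].
Proof.
move=> lf oU Ux.
have [N [S [oN' xN bS NS]]] := compact_built_nbhs lf (@compact_set1 L x).
have Nx : N x by exact: xN.
have [V [oV Vx [x0 Ux0 VP]]] := built_contraction bS (NS _ Nx) oU Ux.
exists (V `&` N); split; [exact: openI | by [] |].
move=> T mT LT A f cA cf fV.
have [f' [cf' ff']] := AE_within LT cA cf.
have oN : open (f' @^-1` (V `&` N)).
  by apply: open_comp; [move=> z _; exact: cf' | exact: openI].
have [|u [cu uA uN]] := metrizable_urysohn mT cA (open_closedC oN).
  by rewrite eqEsubset; split=> // z [Az] /=; rewrite ff'//; apply; exact: fV.
pose G := [set z | u z <= 2^-1]; pose H := [set z | 2^-1 <= u z].
have cG : closed G.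
  by apply: (@preimage_closed _ _ u [set r | r <= 2^-1]) => //; exact: closed_le.
have cH : closed H.
  by apply: (@preimage_closed _ _ u [set r | 2^-1 <= r]) => //; exact: closed_ge.
have GV z : G z -> (V `&` N) (f' z).
  by move=> Gz; apply: contrapT => /uN u1; move: Gz; rewrite /G /= u1; lra.
have [|||F [cF FP]] := VP T G f' (fun z => 2 * u z) cG.
- exact: continuous_subspaceT.
- apply: continuous_subspaceT => z; apply: cvgM; [exact: cvg_cst | exact: cu].
- by move=> z /GV [Vz Nz]; split=> //; exact: NS.
pose g z := if u z <= 2^-1 then F z else x0.
exists g; split.
- apply/withinT; rewrite (_ : setT = G `|` H); last first.
    rewrite eqEsubset; split=> // z _.
    by case: (leP (u z) 2^-1) => [|/ltW]; [left|right].
  apply: withinU_continuous => //.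
    by apply: eq_within cF => z Gz; rewrite /g Gz.
  apply: (eq_within (f := fun=> x0)) => [z Hz|].
    rewrite /g; case: ifPn => // Gz; have [_ _ h] := FP z Gz.
    by apply/esym/h; move: Hz; rewrite /H /=; lra.
  by apply: continuous_subspaceT; exact: cst_continuous.
- by move=> z; rewrite /g; case: ifPn => // Gz; have [] := FP z Gz.
- move=> z Az; have Gz : G z by rewrite /G /= uA// invr_ge0.
  rewrite /g (_ : u z <= 2^-1)//; have [_ h _] := FP z Gz.
  by rewrite h ?ff'// uA// mulr0.
Qed.

End Contraction.

(** * Cubical grids *)

(** In a list of decreasing rank, the tail after [i] holds all entries of smaller rank and none of
    larger rank. *)
Lemma along_sorted (I : eqType) (rk : I -> nat) (Q : I -> seq I -> Prop)
    (l : seq I) : sorted (fun i j => rk j <= rk i)%N l -> uniq l ->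
  (forall i l', i \in l -> i \notin l' -> {subset l' <= l} ->
    (forall j, j \in l' -> rk j <= rk i)%N ->
    (forall k, k \in l -> (rk k < rk i)%N -> k \in l') -> Q i l') ->
  along Q l.
Proof.
elim: l => //= i l IH sl /andP[il ul] H.
have li j : j \in l -> (rk j <= rk i)%N.
  have tr : transitive (fun i j => rk j <= rk i)%N.
    by move=> b a c ab bc; exact: leq_trans bc ab.
  by move: (order_path_min tr sl) => /allP; apply.
split.
  apply: H => //; first by rewrite mem_head.
    by move=> k kl; rewrite in_cons kl orbT.
  by move=> k; rewrite in_cons => /predU1P[->|//]; rewrite ltnn.
apply: IH => //; first exact: path_sorted sl.
move=> j l' jl jl' l'l lj kl'; apply: H => //.
- by rewrite in_cons jl orbT.
- by move=> k /l'l kl; rewrite in_cons kl orbT.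
- move=> k; rewrite in_cons => /predU1P[->|]; last exact: kl'.
  by rewrite ltnNge li.
Qed.

(* Cells of the unit cubical grid: the index [t] of a coordinate stands for the
   point [t / 2] if [t] is even, for the interval [(t-1) / 2, (t+1) / 2] if odd. *)
Section Grid.
Context {R : realType} {J : finType} {m : nat}.
Local Notation cell := {ffun J -> 'I_m.*2.+1}.
Implicit Types (s t : cell) (y : J -> R).

Definition cube s y : Prop :=
  forall j, ((s j)./2)%:R <= y j <= (uphalf (s j))%:R.

Definition cube_dim s : nat := \sum_j odd (s j).

Definition cube_face s t : Prop :=
  (cube_dim t < cube_dim s)%N /\ forall y, cube t y -> cube s y.

(** If some interval factor of [s] has [y] at an endpoint, replacing it by that endpoint gives the
    face. Otherwise [y] is interior to [s], and [t], of no larger dimension, would have to equal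
    [s]. *)
Lemma cube_meet s t y : s != t -> (cube_dim t <= cube_dim s)%N ->
  cube s y -> cube t y -> exists k, cube_face s k /\ cube k y.
Proof.
move=> st ts sy ty.
have face j (v : 'I_m.*2.+1) : odd (s j) -> ~~ odd v ->
    ((s j)./2 <= v./2 <= uphalf (s j))%N -> y j = (v./2)%:R ->
    exists k, cube_face s k /\ cube k y.
  move=> oj ov /andP[v1 v2] yv.
  have v3 : uphalf v = v./2 by rewrite uphalf_half (negPf ov).
  pose k := [ffun j' => if j' == j then v else s j'] : cell.
  have kj : k j = v by rewrite ffunE eqxx.
  have kj' j' : j' != j -> k j' = s j' by rewrite ffunE => /negPf ->.
  exists k; split; [split|].
  - rewrite /cube_dim (bigD1 j)//= [ltnRHS](bigD1 j)//= kj oj (negPf ov).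
    rewrite add0n add1n ltnS leq_eqVlt.
    by rewrite (eq_bigr (fun j => odd (s j) : nat)) ?eqxx// => j' /kj' ->.
  - move=> z kz j'; have := kz j'; have [->|/kj' ->//] := eqVneq j' j.
    rewrite kj v3 => /andP[z1 z2]; apply/andP; split.
      by apply: le_trans z1; rewrite ler_nat.
    by apply: le_trans z2 _; rewrite ler_nat.
  - move=> j'; have [->|/kj' ->//] := eqVneq j' j.
    by rewrite kj v3 yv lexx.
have [[j [oj yj]]|int] := pselect (exists j, odd (s j) /\
    (y j = ((s j)./2)%:R \/ y j = (uphalf (s j))%:R)).
  have sj : (s j = (s j)./2.*2.+1 :> nat) by rewrite -[LHS]odd_double_half oj.
  have us : uphalf (s j) = (s j)./2.+1 by rewrite uphalf_half oj.
  have sm : ((s j)./2.*2.+1 < m.*2.+1)%N by rewrite -sj ltn_ord.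
  case: yj => yj.
    have v1 : ((s j)./2.*2 < m.*2.+1)%N by exact: ltnW.
    apply: (face j (Ordinal v1)) => //=; rewrite ?odd_double// doubleK ?leqnn//.
    by rewrite us leqnSn.
  have v1 : ((uphalf (s j)).*2 < m.*2.+1)%N.
    by rewrite us doubleS; move: sm; rewrite -!muln2; lia.
  by apply: (face j (Ordinal v1)) => //=; rewrite ?odd_double// doubleK ?leqnn// us leqnSn.
exfalso; move/eqP: st; apply.
have same j : odd (s j) -> t j = s j.
  move=> oj; have := sy j; have := ty j; rewrite !uphalf_half oj.
  move=> /andP[t1 t2] /andP[s1 s2].
  have s1' : ((s j)./2)%:R < y j.
    by rewrite lt_neqAle s1 andbT; apply/eqP => e; apply: int; exists j; split=> //; left.
  have s2' : y j < (1 + (s j)./2)%:R.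
    rewrite lt_neqAle s2 andbT; apply/eqP => e; apply: int; exists j; split=> //.
    by right; rewrite uphalf_half oj.
  have := le_lt_trans t1 s2'; have := lt_le_trans s1' t2; rewrite !ltr_nat.
  move=> a b; apply: val_inj => /=.
  rewrite -(odd_double_half (t j)) -(odd_double_half (s j)) oj.
  case: (odd (t j)) a b => /= a b; first by congr (_ + _.*2)%N; lia.
  by exfalso; move: a b; lia.
(* Interval factors of [s] are interval factors of [t]; since [t] has no more of them, the parities
   agree everywhere. *)
have le j : (odd (s j) <= odd (t j))%N.
  by case: (boolP (odd (s j))) => // oj; rewrite same ?oj.
have oE : forall j, odd (s j) = odd (t j).
  have /leqifP := leqif_sum (fun j (_ : true) => leqif_eq (le j)).
  rewrite -/(cube_dim s) -/(cube_dim t); case: ifPn => [/forallP st _ j|_].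
    by have /= /eqP := st j; case: (odd _); case: (odd _).
  by rewrite ltnNge ts.
apply/ffunP => j; have [/same->//|ej] := boolP (odd (s j)).
have et : ~~ odd (t j) by rewrite -oE.
have := sy j; have := ty j; rewrite !uphalf_half (negPf ej) (negPf et) !add0n.
move=> /le_anti t1 /le_anti s1; apply: val_inj => /=.
rewrite -(odd_double_half (t j)) -(odd_double_half (s j)) (negPf ej) (negPf et).
congr (_ + _.*2)%N; apply/eqP; rewrite -(eqr_nat R).
by rewrite s1 t1.
Qed.

End Grid.

(** Preimages of the cells of a grid of mesh [e], after a shift by the bound [B] that makes all
    coordinates nonnegative. Only nonempty ones are listed, by decreasing dimension. *)
Lemma grid_cover (R : realType) (L : topologicalType) (J : finType)
    (psi : J -> L -> R) (G : set L) (e : R) : 0 < e -> compact G -> closed G ->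
  (forall j, {within G, continuous (psi j)}) ->
  exists (I : eqType) (l : seq I) (rk : I -> nat) (bd : I -> I -> Prop)
    (D : I -> set L), [/\
    uniq l /\ (forall i, rk i <= #|J|)%N,
    forall i k, bd i k -> (rk k < rk i)%N /\ D k `<=` D i,
    G = \bigcup_(i in [set` l]) D i /\ forall i, i \in l -> D i !=set0,
    forall i, closed (D i) /\ forall x y j, D i x -> D i y ->
      `|psi j x - psi j y| <= e &
    along (face_meet bd D) l].
Proof.
move=> e0 kG cG cpsi.
have [B BP] : exists B : R, forall j x, G x -> `|psi j x| <= B.
  have bnd j : exists B : R, forall x, G x -> `|psi j x| <= B.
    have k : compact (psi j @` G : set R^o) by exact: continuous_compact.
    have [M [_ MP]] := compact_bounded k; exists (M + 1) => x Gx.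
    by apply: (MP (M + 1)); [rewrite ltrDl | exists x].
  have [B BP] := choice bnd; exists (\sum_j `|B j|) => j x Gx.
  apply: le_trans (BP j x Gx) _; apply: le_trans (ler_norm _) _.
  by rewrite (bigD1 j)//= lerDl; apply: sumr_ge0 => *; exact: normr_ge0.
pose y x j := (psi j x + B) / e.
have y0 x j : G x -> 0 <= y x j.
  by move=> Gx; have := BP j x Gx; rewrite ler_norml /y => ?; apply: divr_ge0; lra.
pose m := (Num.truncn (2 * B / e)).+1.
have ym x j : G x -> y x j < m%:R.
  move=> Gx; apply: le_lt_trans (truncnS_gt _).
  by rewrite /y ler_pM2r ?invr_gt0//; have := BP j x Gx; rewrite ler_norml; lra.
pose I := {ffun J -> 'I_m.*2.+1}.
pose D (s : I) := [set x | G x /\ cube s (y x)].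
pose l := sort (fun s t : I => cube_dim t <= cube_dim s)%N
               [seq s <- enum {: I} | `[< D s !=set0 >]].
have lP s : s \in l = `[< D s !=set0 >].
  by rewrite mem_sort mem_filter mem_enum andbT.
have ul : uniq l by rewrite sort_uniq filter_uniq// enum_uniq.
have Dl s x : D s x -> s \in l by move=> Ds; rewrite lP; apply/asboolP; exists x.
exists I, l, cube_dim, (@cube_face R J m), D; split.
- split=> // s; rewrite -sum1_card; apply: leq_sum => j _; exact: leq_b1.
- by move=> s t [ts tDs]; split=> // x [Gx xt]; split=> //; exact: tDs.
- split; last by move=> s; rewrite lP => /asboolP.
  rewrite eqEsubset; split=> [x Gx|x [s _ []]//].
  (* The odd index built from the integer part names the unit interval containing [y x j]. *)
  have tm j : ((Num.truncn (y x j)).*2.+1 < m.*2.+1)%N.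
    rewrite ltnS ltn_double -(ltr_nat R); apply: le_lt_trans (ym x j Gx).
    by rewrite truncn_le y0.
  pose s := [ffun j => Ordinal (tm j)] : I.
  have Ds : D s x.
    split=> // j; rewrite ffunE /= uphalf_double doubleK.
    by rewrite truncn_le ?y0//= ltW// truncnS_gt.
  by exists s => //; exact: Dl Ds.
- move=> s; split.
    have -> : D s = G `&` \bigcap_(j in setT) (G `&` psi j @^-1`
       [set r | ((s j)./2)%:R <= (r + B) / e <= (uphalf (s j))%:R]).
      rewrite eqEsubset; split=> x [Gx xs]; split=> // j; first by split=> //; exact: xs.
      by have [] := xs j Logic.I.
    apply: closedI => //; apply: closed_bigI => j _.
    apply: ((within_closedP _ cG).1 (cpsi j)).
    rewrite (_ : mkset _ = `[((s j)./2)%:R * e - B, (uphalf (s j))%:R * e - B]%classic).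
      exact: interval_closed.
    rewrite eqEsubset; split=> r /=; rewrite in_itv /=.
      by rewrite ler_pdivlMr// ler_pdivrMr//; lra.
    by rewrite ler_pdivlMr// ler_pdivrMr//; lra.
  move=> x z j [_ /(_ j)/andP[x1 x2]] [_ /(_ j)/andP[z1 z2]].
  have h : (uphalf (s j))%:R <= ((s j)./2)%:R + 1 :> R.
    by rewrite uphalf_half natrD addrC lerD2l lern1 leq_b1.
  have -> : psi j x - psi j z = (y x j - y z j) * e.
    by rewrite /y -mulrBl divfK ?gt_eqF//; ring.
  rewrite normrM (gtr0_norm e0) -[leRHS]mul1r ler_pM2r// ler_norml; lra.
- apply: (along_sorted (rk := cube_dim)) => //.
    by apply: sort_sorted => s t; exact: leq_total.
  move=> s l' sl sl' l'l le lt t x tl' [Gx xs] [_ xt].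
  have [||||k [sk kx]] := @cube_meet _ _ _ s t (y x).
  + by apply: contraNneq sl' => ->.
  + exact: le.
  + exact: xs.
  + exact: xt.
  exists k; split=> //; apply: lt; last by case: sk.
  by apply: (Dl k x); split.
Qed.

(** * Uniform local extension and the theorem *)

Lemma partial_extS (T Y : topologicalType) (V V' U U' : set Y) :
  V' `<=` V -> U `<=` U' -> partial_ext T V U -> partial_ext T V' U'.
Proof.
move=> VV UU VU A f cA cf fV; have [|g [cg gU gf]] := VU A f cA cf.
  by move=> x /fV/VV.
by exists g; split=> // x; exact/UU/gU.
Qed.

(** * Balls in the coordinates of a finite subcomplex *)

Section CoordinateBalls.
Context {R : realType} {L : topologicalType} (C : CWcomplex R L).
Hypothesis lf : cw_locally_finite C.
Variables (S : set (cw_idx C)) (J : finType) (psi : J -> L -> R) (W : set L).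
Local Notation K := (Defs.support S).
Hypotheses (bS : built S) (oW : open W) (WK : W `<=` K).
Hypothesis cpsi : forall j, {within K, continuous (psi j)}.
Hypothesis Ipsi : forall x y, K x -> K y -> (forall j, psi j x = psi j y) -> x = y.
Implicit Types (x y : L) (d e : R).

Definition coord_ball x e : set L :=
  [set y | W y /\ forall j, `|psi j y - psi j x| < e].

Let cont_dist x j : {within K, continuous (fun y => `|psi j y - psi j x|)}.
Proof.
by move=> y; apply: cvg_norm; apply: cvgB; [exact: cpsi | exact: cvg_cst].
Qed.

Lemma coord_ball_center x e : 0 < e -> W x -> coord_ball x e x.
Proof. by move=> e0 Wx; split=> // j; rewrite subrr normr0. Qed.

Lemma open_coord_ball x e : open (coord_ball x e).
Proof.
rewrite openE => y [Wy yx]; rewrite /interior.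
have nW : nbhs y W by exact: open_nbhs_nbhs.
have nJ : nbhs y [set z | forall j, W z -> `|psi j z - psi j x| < e].
  apply: filter_forall => j.
  have /within_openP/(_ y [set r | r < e] (WK Wy)) := @cont_dist x j.
  move=> /(_ (@open_lt _ e) (yx j)) [U [oU Uy Ue]].
  apply: filterS (open_nbhs_nbhs (conj oU Uy)) => z Uz Wz.
  by apply: Ue => //; exact: WK.
by apply: filterS2 nW nJ => z Wz zx; split=> // j; exact: zx.
Qed.

(** Each point of the compact set [K] minus [V] differs from [x] in some coordinate, so it has a
    neighbourhood missed by all small balls about [x]. *)
Lemma coord_ball_basis x (V : set L) : W x -> open V -> V x ->
  \forall d \near 0^'+, coord_ball x d `<=` V.
Proof.
move=> Wx oV Vx.
have kV : compact (K `&` ~` V).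
  by apply: compact_closedI; [exact: built_compact | exact: open_closedC].
have /compact_near_coveringP/near_covering_withinP cov := kV.
have H : forall y, (K `&` ~` V) y -> \forall y' \near y & d \near 0^'+,
    (K `&` ~` V) y' -> ~ coord_ball x d y'.
  move=> y [Ky nVy].
  have [j jxy] : exists j, psi j y != psi j x.
    apply: contrapT => nj; apply: nVy; rewrite (Ipsi Ky (WK Wx))// => j.
    by apply/eqP/negPn/negP => jn; apply: nj; exists j.
  have c0 : 0 < `|psi j y - psi j x| / 2 by rewrite divr_gt0// normr_gt0 subr_eq0.
  set c := _ / 2 in c0.
  have /within_openP/(_ y [set r | c < r] Ky (@open_gt _ c)) := @cont_dist x j.
  case=> [|U [oU Uy Uc]]; first by rewrite /= /c; move: c0; rewrite /c; lra.
  exists (U, [set d | d < c]); first split=> /=.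
  - exact: open_nbhs_nbhs.
  - exact: nbhs_right_lt.
  move=> [y' d] /= [Uy' dc] [Ky' _] [_ /(_ j)].
  by have /= := Uc y' Ky' Uy'; lra.
apply: filterS (cov _ _ _ _ H) => d Kd y [Wy yd]; apply: contrapT => nVy.
by apply: (Kd y); split=> //; exact: WK.
Qed.

(** A Lebesgue number argument: [local_extension] at [x] serves all centres [y] close to [x], and
    [G] is compact. *)
Lemma uniform_local_extension (G : set L) e : compact G -> G `<=` W -> 0 < e ->
  exists d, [/\ 0 < d, d <= e & forall x, G x -> forall T : topologicalType,
    metrizable R T -> AE L T -> partial_ext T (coord_ball x d) (coord_ball x e)].
Proof.
move=> /compact_near_coveringP kG GW e0.
pose P d x := forall T : topologicalType,
  metrizable R T -> AE L T -> partial_ext T (coord_ball x d) (coord_ball x e).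
have : \forall d \near 0^'+, G `<=` P d.
  apply: kG => x Gx; have Wx := GW x Gx; have e2 : 0 < e / 2 by rewrite divr_gt0.
  have [V [oV Vx VP]] := local_extension lf (open_coord_ball x (e / 2))
    (coord_ball_center e2 Wx).
  have [d0 /= d00 d0V] := coord_ball_basis Wx oV Vx.
  (* For [y] within [r] of [x] and [d < r], the [d]-ball about [y] lies in the [2r]-ball about [x],
     hence in [V], and the [e/2]-ball about [x] lies in the [e]-ball about [y]. *)
  pose r := Num.min (d0 / 4) (e / 2).
  have r0 : 0 < r by rewrite lt_min e2 divr_gt0.
  have rd : 2 * r < d0 by have : r <= d0 / 4 by [rewrite ge_min lexx]; lra.
  have re : r <= e / 2 by rewrite ge_min lexx orbT.
  exists (coord_ball x r, [set d | d < r]); first split=> /=.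
  - apply: open_nbhs_nbhs; split; [exact: open_coord_ball|exact: coord_ball_center].
  - exact: nbhs_right_lt.
  move=> [y d] /= [[Wy yr] dr] T mT LT.
  apply: partial_extS (VP T mT LT) => z [Wz zP].
    apply: (d0V (2 * r)) => /=.
    - by rewrite sub0r normrN gtr0_norm//; lra.
    - by lra.
    split=> // j; have := zP j; have := yr j.
    by have := ler_distD (psi j y) (psi j z) (psi j x); lra.
  split=> // j; have := zP j; have := yr j.
  by have := ler_distD (psi j x) (psi j z) (psi j y); rewrite (distrC (psi j y)); lra.
move=> nP; have : \forall d \near 0^'+, [/\ 0 < d, d < e & G `<=` P d].
  by apply: filterS3 (nbhs_right_gt 0) (nbhs_right_lt e0) nP => d ? ? ?; split.
by move=> /filter_ex [d [d0 de dP]]; exists d; split=> //; exact: ltW.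
Qed.

(** The factor 2 leaves room for moving the centre of a ball from a face to a cell containing it. *)
Lemma extension_radii (G : set L) : compact G -> G `<=` W ->
  exists r : nat -> R, [/\ forall n, 0 < r n,
    forall m n, (m <= n)%N -> r n <= r m &
    forall n x, G x -> forall T : topologicalType, metrizable R T -> AE L T ->
      partial_ext T (coord_ball x (2 * r n.+1)) (coord_ball x (r n))].
Proof.
move=> kG GW.
have H e : exists d, 0 < e -> [/\ 0 < d, d <= e & forall x, G x ->
    forall T : topologicalType, metrizable R T -> AE L T ->
    partial_ext T (coord_ball x d) (coord_ball x e)].
  have [e0|] := ltP 0 e; last by exists 0 => e0; move: e0; lra.
  by have [d dP] := uniform_local_extension kG GW e0; exists d.
have [d dP] := choice H; pose r n := iter n (fun e => d e / 2) 1.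
have r0 n : 0 < r n.
  elim: n => [|n IH]; first exact: ltr01.
  by rewrite /r iterS divr_gt0//; case: (dP _ IH).
exists r; split=> // [m n|n x Gx T mT LT].
  elim: n => [|n IH]; first by rewrite leqn0 => /eqP ->.
  rewrite leq_eqVlt => /predU1P[->//|/IH]; apply: le_trans.
  by rewrite /r iterS -/(r n); have [] := dP _ (r0 n); lra.
have [_ _ dE] := dP _ (r0 n).
by rewrite /r iterS -/(r n) mulrC divfK ?pnatr_eq0//; exact: dE.
Qed.

End CoordinateBalls.

(** * From the universal compactum to quasi-finiteness *)

Theorem theorem3p5 (R : realType) (L : topologicalType) (C : CWcomplex R L) :
  cw_countable C -> cw_locally_finite C ->
  forall XL : topologicalType,
    metrizable_compactum R XL -> edim_le XL L ->
    (forall K : topologicalType,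
        metrizable_compactum R K -> edim_le K L -> embeds K XL) ->
    AE_polish R L XL ->
  quasi_finite C.
Proof.
move=> _ lf X cX LX uX aX P fP.
(* If [L] is empty, any extension to [L] shows that [Z] is empty, and [P] itself will do. *)
have [[l0 _]|nL] := pselect (exists x : L, True); last first.
  exists P; split=> // Z _ LZ A f cA cf fP'; have [g [cg gf]] := LZ A f cA cf.
  by exists g; split=> // z; case: nL; exists (g z).
have hL := cw_hausdorff C.
(* Nested neighbourhoods: [S0] contains [P], its support lies in [U1], then come the gridded
   compactum [G], the open set [W] holding all balls, and the support of [S2]. *)
have [S0 [bS0 PS0]] := built_finite fP.2.
have [U1 [S1 [oU1 SU1 bS1 US1]]] := compact_built_nbhs lf (built_compact bS0).
have [W [S2 [oW SW bS2 WS2]]] := compact_built_nbhs lf (built_compact bS1).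
set G := Defs.support S1 in US1 SW.
have kG : compact G by exact: built_compact.
have cG : closed G by exact: compact_closed.
have [J [psi [cpsi Ipsi]]] := built_embedding bS2.
have [r [r0 rm rext]] := extension_radii lf bS2 oW WS2 cpsi Ipsi kG SW.
pose N := #|J|.
(* Cells have dimension at most [N], and the two phases below use radii of index at most [2N + 2];
   the mesh is the last and smallest of these. *)
have [|I [l [rk [bd [D [[ul rkN] bdP [GD D0] Dcl lD]]]]]] :=
    grid_cover (e := r (N + N).+2) (r0 _) kG cG (psi := psi).
  by move=> j; apply: continuous_subspaceW (cpsi j); exact: subset_trans WS2.
have [x xP] : exists x : I -> L, forall i, i \in l -> D i (x i).
  have H i : exists x, i \in l -> D i x.
    have [il|] := boolP (i \in l); last by exists l0.
    by have [x Dx] := D0 i il; exists x.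
  by have [x xP] := choice H; exists x.
have DG i : i \in l -> D i `<=` G by move=> il; rewrite GD => z; exists i.
have Gx i : i \in l -> G (x i) by move=> il; apply: (DG i il); exact: xP.
pose ball := coord_ball psi W.
(* The centres of a cell and of its face both lie in [D i], hence differ by at most the mesh in each
   coordinate. *)
have ball_face n i k : i \in l -> k \in l -> bd i k -> (n <= (N + N).+2)%N ->
    ball (x k) (r n) `<=` ball (x i) (2 * r n).
  move=> il kl ik nN y [Wy yP]; split=> // j.
  have := yP j; have := ler_distD (psi j (x k)) (psi j y) (psi j (x i)).
  have := (Dcl i).2 _ _ j ((bdP i k ik).2 _ (xP k kl)) (xP i il).
  by have := rm n (N + N).+2 nN; lra.
have ballS i a b : a <= b -> ball (x i) a `<=` ball (x i) b.
  by move=> ab y [Wy yP]; split=> // j; exact: lt_le_trans ab.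
have D_ball i n : i \in l -> (n <= (N + N).+2)%N -> D i `<=` ball (x i) (2 * r n).
  move=> il nN y Dy; split; first by apply: SW; exact: DG Dy.
  move=> j; have := (Dcl i).2 _ _ j Dy (xP i il).
  by have := rm n (N + N).+2 nN; have := r0 n; lra.
have [Xs [cXs mXs sXs]] := copies_realize l0 cX LX uX aX bd ul.
(* First phase: radii [r (N+N+1), ..., r (N+1)] according to the dimension. *)
pose s1 i := ball (x i) (r (N + N - rk i).+1).
pose t1 i := ball (x i) (2 * r (N + N - rk i).+2).
have [h0 _] := AE_exists LX.
have [|||||||h1 [ch1 _ hP]] := @carrier_extension X L I bd l Xs t1 s1 set0 h0.
- exact: closed0.
- exact: continuous_subspace0.
- by move=> i /cXs; exact: (closed_copy cX).
- move=> i il; apply: rext => //; [exact: Gx | by case: cX].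
- by [].
- exact: mXs.
(* A face has smaller dimension, hence a larger index and a radius small enough for the cell. *)
- apply: along_sub sXs => i l' il l'l _ k kl ik.
  have kl' := l'l _ kl; have [ki _] := bdP i k ik; have ri := rkN i.
  apply: subset_trans (ball_face (N + N - rk i).+2 i k il kl' ik _); last by lia.
  by apply: ballS; apply: rm; lia.
have cU : closed [set y | exists2 k, k \in l & Xs k y].
  rewrite (_ : mkset _ = [set y | exists k, [/\ k \in l, True & Xs k y]]).
    by apply: closed_seq_union => k /cXs; exact: (closed_copy cX).
  by rewrite eqEsubset; split=> y; [case=> k|case=> k []]; exists k.
rewrite set0U in ch1; have [h [ch hE]] := AE_within LX cU ch1.
have hs i y : i \in l -> Xs i y -> s1 i (h y).
  by move=> il iy; rewrite hE; [exact: hP | exists i].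
have khX : compact (range h).
  by apply: continuous_compact; [exact: continuous_subspaceT | case: cX].
have [U3 [S3 [_ hU3 bS3 US3]]] := compact_built_nbhs lf khX.
have [sP fP'] := fP.
have [sS2 fS2] := built_finite_subcomplex bS2.
have [sS3 fS3] := built_finite_subcomplex bS3.
(* [S2] will hold the values over the grid cells and [S3] those of [h]. *)
exists (P `|` (S2 `|` S3)); split.
- split; last by rewrite !finite_setU.
  move=> i [Pi|[Si|Si]].
  + by apply: subset_trans (sP i Pi) _; apply: supp_sub => j; left.
  + by apply: subset_trans (sS2 i Si) _; apply: supp_sub => j; right; left.
  + by apply: subset_trans (sS3 i Si) _; apply: supp_sub => j; right; right.
- by move=> i; left.
move=> Z pZ LZ A f cA cf fV.
have mZ := polish_metrizable pZ.
have [f' [cf' ff']] := LZ A f cA cf.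
have fU1 a : A a -> U1 (f' a).
  move=> Aa; rewrite (ff' (exist _ a Aa)); apply: SU1.
  exact: supp_sub PS0 _ (fV _).
have oN : open (f' @^-1` U1) by apply: open_comp => // z _; exact: cf'.
(* [u] is 0 on [A] and 1 wherever [f'] leaves [U1]. *)
have [|u [cu uA uN]] := metrizable_urysohn mZ cA (open_closedC oN).
  by rewrite eqEsubset; split=> // z [/fU1].
pose T i := f' @^-1` D i.
have cT i : closed (T i).
  by apply: preimage_closed; [move=> z _; exact: cf' | case: (Dcl i)].
have lT : along (face_meet bd T) l.
  apply: along_sub lD => i l' _ _ DD j z jl Tz Tz'.
  by have [k kP] := DD j _ jl Tz Tz'; exists k.
have XZ : AE X Z by exact: aX.
have [p0 _] := AE_exists XZ.
(* The sets [T i] meet along faces, and copies of faces lie in the copies of their cells, so [p1]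
   can be built cell by cell; [p0] is a dummy prescribed on the empty set. *)
have [|||||||p1 [cp1 _ pP]] := @carrier_extension Z X I bd l T Xs Xs set0 p0.
- exact: closed0.
- exact: continuous_subspace0.
- by move=> i _; exact: cT.
- move=> i il; apply: (copy_partial_ext cX aX) => //; exact: cXs.
- by [].
- exact: lT.
- exact: sXs.
have cTU : closed [set z | exists2 k, k \in l & T k z].
  rewrite (_ : mkset _ = [set z | exists k, [/\ k \in l, True & T k z]]).
    by apply: closed_seq_union => k _; exact: cT.
  by rewrite eqEsubset; split=> y; [case=> k|case=> k []]; exists k.
rewrite set0U in cp1; have [p [cp pE]] := AE_within XZ cTU cp1.
pose g z := h (p z).
have cg : continuous g by move=> z; apply: continuous_comp; [exact: cp|exact: ch].
have gs i z : i \in l -> T i z -> s1 i (g z).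
  by move=> il Tz; apply: hs => //; rewrite pE; [exact: pP | exists i].
(* Second phase: connect [f'] on [A] to [g] on [u = 1], cell by cell. *)
pose B := [set z | 1 <= u z].
have cB : closed B.
  by apply: (@preimage_closed _ _ u [set a | 1 <= a]); [move=> z _; exact: cu|exact: closed_ge].
pose F0 z := if 1 <= u z then g z else f' z.
have F0B z : B z -> F0 z = g z by rewrite /F0 => ->.
have F0A z : A z -> F0 z = f' z by move=> Az; rewrite /F0 uA// ler10.
pose s2 i := ball (x i) (r (N - rk i)%N).
pose t2 i := ball (x i) (2 * r (N - rk i).+1).
have [|||||||F [cF FE FP]] := @carrier_extension Z L I bd l T t2 s2 (A `|` B) F0.
- exact: closedU.
- apply: withinU_continuous => //.
    by apply: (eq_within (f := f')) => [z /F0A ->//|]; exact: continuous_subspaceT.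
  by apply: (eq_within (f := g)) => [z /F0B ->//|]; exact: continuous_subspaceT.
- by move=> i _; exact: cT.
- by move=> i il; apply: rext => //; exact: Gx.
(* On [A] the value lies in [D i], within the mesh of [x i]; on [B] it lies in [s1 i], whose radius
   is at most [r (N - rk i).+1]. *)
- move=> i z il Tz; have ri := rkN i; case=> [Az|Bz].
    by rewrite F0A//; apply: D_ball => //; lia.
  rewrite F0B//; apply: ballS (gs i z il Tz).
  have := rm (N - rk i).+1 (N + N - rk i).+1; have := r0 (N - rk i).+1.
  by move=> a b; have := b (ltac:(lia)); lra.
- exact: lT.
- apply: along_sub sXs => i l' il l'l _ k kl ik.
  have kl' := l'l _ kl; have [ki _] := bdP i k ik; have ri := rkN i.
  apply: subset_trans (ball_face (N - rk i).+1 i k il kl' ik _); last by lia.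
  by apply: ballS; apply: rm; lia.
(* Where [f'] is in [U1] its value lies in some grid cell; elsewhere [u = 1]. So [F] is controlled
   on all of [Z]. *)
have ZE z : B z \/ exists2 i, i \in l & T i z.
  have [Oz|/uN uz] := pselect ((f' @^-1` U1) z); last by left; rewrite /B /= uz.
  by right; have := US1 _ Oz; rewrite GD => -[i il Dz]; exists i.
exists F; split.
- apply/withinT; rewrite (_ : setT = (A `|` B) `|` [set z | exists2 k, k \in l & T k z])//.
  by rewrite eqEsubset; split=> // z _; case: (ZE z) => [|]; [left; right|right].
- move=> z; have [Bz|[i il Tz]] := ZE z.
    rewrite FE ?F0B//; last by right.
    by apply: (@supp_sub _ _ _ S3); [move=> j; right; right|apply/US3/hU3; exists (p z)].
  have [Wz _] := FP i z il Tz.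
  by apply: (@supp_sub _ _ _ S2); [move=> j; right; left | exact: WS2].
- by move=> a; have Aa := svalP a; rewrite FE ?F0A ?ff'//; left.
Qed.
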